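(* Let $v$ be a typical weight, let $T$ be an intrinsic operator on $\mathcal{H}(\mathbb{D})$ and let $X$ be an initial space. (a) If $T:X\to H_{v,0}$ is bounded, then (i) $T:X\to H_{v,0}$ is compact if and only if $\lim_{|z|\to1}v(z)\|T^*K_z^H\|=0$; and (ii) $T:X\to H_{v,0}$ is weakly compact if and only if $v(z)T^*K_z^H\to0$ weakly in $X^*$ as $|z|\to1$. (b) If $T:X\to\mathcal{B}_{v,0}$ is bounded, then (i) $T:X\to\mathcal{B}_{v,0}$ is compact if and only if $\lim_{|z|\to1}v(z)\|T^*K_{z,1}^{\mathcal{B}}\|=0$; and (ii) $T:X\to\mathcal{B}_{v,0}$ is weakly compact if and only if $v(z)T^*K_{z,1}^{\mathcal{B}}\to0$ weakly in $X^*$ as $|z|\to1$.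
   Context: $\mathcal{H}(\mathbb{D})$ is the space of holomorphic functions on the unit disk $\mathbb{D}$ with the topology $\tau_{uc}$ of uniform convergence on compact subsets. A linear operator $T$ on $\mathcal{H}(\mathbb{D})$ is intrinsic if it maps $\tau_{uc}$-convergent sequences to $\tau_{uc}$-convergent sequences. An initial space is a Banach space $X\subset\mathcal{H}(\mathbb{D})$ containing the polynomials such that every sequence in the closed unit ball of $X$ has a subsequence converging in $\tau_{uc}$ to some function in $X$. A typical weight is a continuous radial $v:\mathbb{D}\to(0,1]$, non-increasing in $|z|$, with $v(z)\to0$ as $|z|\to1$. $H_{v,0}=\{f\in\mathcal{H}(\mathbb{D}):\lim_{|z|\to1}v(z)|f(z)|=0\}$ with norm $\sup_z v(z)|f(z)|$; $\mathcal{B}_{v,0}=\{f:\lim_{|z|\to1}v(z)|f'(z)|=0\}$ with norm $|f(0)|+\sup_z v(z)|f'(z)|$. $K_z^H$ is the point evaluation $g\mapsto g(z)$ on $H_{v,0}$, $K_{z,1}^{\mathcal{B}}$ the derivative point evaluation $g\mapsto g'(z)$ on $\mathcal{B}_{v,0}$, and $T^*$ the Banach-space adjoint of $T:X\to H_{v,0}$ (resp. $\mathcal{B}_{v,0}$). *)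

(* Defs.v *)
From mathcomp Require Import all_boot all_order all_algebra.
From mathcomp Require Import all_classical all_reals all_analysis.
From mathcomp Require Import complex.
Set Implicit Arguments.
Unset Strict Implicit.
Unset Printing Implicit Defensive.
Import Order.TTheory GRing.Theory Num.Theory.
Local Open Scope classical_set_scope.
Local Open Scope ring_scope.

Section Defs.
Context {R : realType}.
Local Notation C := (R[i]).

Definition cabs (z : C) : R := complex.Re `|z|.

Definition disk : set C := [set z | cabs z < 1].

Definition holo (f : C -> C) : Prop :=
  forall z, disk z -> derivable (f : C^o -> C^o) z 1.

Definition cderiv (f : C -> C) (z : C) : C := 'D_1 (f : C^o -> C^o) z.

(* equality as functions on D (elements of H(D) are functions on D) *)
Definition eqD (f g : C -> C) : Prop := forall z, disk z -> f z = g z.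

Definition near_boundary (P : C -> Prop) : Prop :=
  exists r : R, r < 1 /\ forall z, r < cabs z < 1 -> P z.

Definition vanishes_at_boundary (g : C -> R) : Prop :=
  forall e : R, 0 < e -> near_boundary (fun z => `|g z| < e).

Definition typical_weight (v : C -> R) : Prop :=
  [/\ (forall z : C^o, disk z -> (v : C^o -> R^o) @ z --> (v z : R^o)),
      (forall z, disk z -> 0 < v z <= 1),
      (forall z w, disk z -> disk w -> cabs z = cabs w -> v z = v w),
      (forall z w, disk z -> disk w -> cabs z <= cabs w -> v w <= v z)
    & vanishes_at_boundary v].

Definition uc_cvg (u : nat -> C -> C) (f : C -> C) : Prop :=
  forall K : set C^o, compact K -> K `<=` disk ->
  forall e : R, 0 < e ->
  \forall n \near \oo, forall z, K z -> cabs (u n z - f z) < e.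

Definition intrinsic (T : (C -> C) -> (C -> C)) : Prop :=
  [/\ (forall f, holo f -> holo (T f)),
      (forall f g, holo f -> holo g -> eqD f g -> eqD (T f) (T g)),
      (forall (a : C) f g, holo f -> holo g ->
          eqD (T (fun z => a * f z + g z)) (fun z => a * T f z + T g z))
    & (forall u f, (forall n, holo (u n)) -> holo f -> uc_cvg u f ->
          exists g, holo g /\ uc_cvg (fun n => T (u n)) g)].

(* An initial space X is represented by a Banach space V over C together with
   a linear injective embedding j : V -> H(D). *)
Definition initial_space (V : completeNormedModType C) (j : V -> C -> C) : Prop :=
  [/\ (forall x, holo (j x)),
      (forall (a : C) x y, eqD (j (a *: x + y)) (fun z => a * j x z + j y z)),
      (forall x y, eqD (j x) (j y) -> x = y),
      (forall p : {poly C}, exists x, eqD (j x) (fun z => p.[z]))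
    & (forall u : nat -> V, (forall n, `|u n| <= 1) ->
         exists (phi : nat -> nat) (x : V),
           {homo phi : m n / (m < n)%N} /\ uc_cvg (fun n => j (u (phi n))) (j x))].

Definition Hv0 (v : C -> R) (g : C -> C) : Prop :=
  holo g /\ vanishes_at_boundary (fun z => v z * cabs (g z)).
Definition normHv (v : C -> R) (g : C -> C) : R :=
  sup [set v z * cabs (g z) | z in disk].
Definition Bv0 (v : C -> R) (g : C -> C) : Prop :=
  holo g /\ vanishes_at_boundary (fun z => v z * cabs (cderiv g z)).
Definition normBv (v : C -> R) (g : C -> C) : R :=
  cabs (g 0) + sup [set v z * cabs (cderiv g z) | z in disk].

Definition evalK (z : C) : (C -> C) -> C := fun g => g z.
Definition evalD (z : C) : (C -> C) -> C := fun g => cderiv g z.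

Section Operators.
Context (V : completeNormedModType C) (j : V -> C -> C).
Context (Y : (C -> C) -> Prop) (nY : (C -> C) -> R).

Definition bounded_op (T : (C -> C) -> (C -> C)) : Prop :=
  (forall x, Y (T (j x))) /\
  exists M : R, forall x : V, `|x| <= 1 -> nY (T (j x)) <= M.

Definition compact_op (T : (C -> C) -> (C -> C)) : Prop :=
  forall u : nat -> V, (forall n, `|u n| <= 1) ->
  exists (phi : nat -> nat) (g : C -> C),
    [/\ {homo phi : m n / (m < n)%N}, Y g &
        ((fun n => nY (fun z => T (j (u (phi n))) z - g z)) : nat -> R^o) @ \oo --> (0 : R^o)].

Definition Ydual (L : (C -> C) -> C) : Prop :=
  (forall (a : C) f g, Y f -> Y g -> L (fun z => a * f z + g z) = a * L f + L g) /\
  exists M : R, forall f, Y f -> cabs (L f) <= M * nY f.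

(* T : X -> Y weakly compact: T(B_X) is relatively compact in the weak
   topology of Y, i.e. every proper filter on B_X has an image with a weak
   cluster point in Y *)
Definition wcompact_op (T : (C -> C) -> (C -> C)) : Prop :=
  forall F : set_system V, ProperFilter F -> F [set x | `|x| <= 1] ->
  exists g : C -> C, Y g /\
    forall (k : nat) (Ls : nat -> (C -> C) -> C) (e : R),
      (forall i, (i < k)%N -> Ydual (Ls i)) -> 0 < e ->
      forall A, F A -> exists x, A x /\
        forall i, (i < k)%N -> cabs (Ls i (T (j x)) - Ls i g) < e.

Definition adjoint (T : (C -> C) -> (C -> C)) (L : (C -> C) -> C) : V -> C :=
  fun x => L (T (j x)).
End Operators.

Section Duals.
Context (V : completeNormedModType C).
Definition Xdual (phi : V -> C) : Prop :=
  (forall (a : C) x y, phi (a *: x + y) = a * phi x + phi y) /\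
  exists M : R, forall x, cabs (phi x) <= M * complex.Re `|x|.
Definition dnorm (phi : V -> C) : R :=
  sup [set cabs (phi x) | x in [set x : V | `|x| <= 1]].
Definition rscale (a : R) (phi : V -> C) : V -> C :=
  fun x => (a%:C)%C * phi x.
Definition Xbidual (Psi : (V -> C) -> C) : Prop :=
  (forall (a : C) phi psi, Xdual phi -> Xdual psi ->
      Psi (fun x => a * phi x + psi x) = a * Psi phi + Psi psi) /\
  exists M : R, forall phi, Xdual phi -> cabs (Psi phi) <= M * dnorm phi.
Definition weak_vanishes (Phi : C -> V -> C) : Prop :=
  forall Psi, Xbidual Psi -> vanishes_at_boundary (fun z => cabs (Psi (Phi z))).
End Duals.

End Defs.

(* Main.v *)
(** Both spaces are instances of {g holomorphic : v |E g| -> 0 at the boundary}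
    with norm c |g(0)| + sup v |E g|, where E is the identity or the derivative.
    All that is needed of E is linearity and that uc-convergence g_n -> 0 forces
    E g_n -> 0 uniformly on compacts; for the derivative this is the Cauchy
    estimate, obtained from Goursat's lemma on squares.

    Compactness: on |z| <= r use uc-convergence of T u_n, on |z| > r the decay of
    v(z) ||T^* K_z||; conversely test on vectors almost norming T^* K_z.

    Weak compactness: if T is weakly compact, Goldstine's theorem yields, for Psi
    in X^**, some g in the target with Psi(T^* K_z) = (E g)(z), which has the
    required decay.  In the other direction, a filter on the unit ball of X
    clusters in the uc-topology at some x0 in X, and a bounded sequence of the
    target space that tends to 0 in the uc-topology tends to 0 weakly by a
    gliding hump argument; hence T x0 is a weak cluster point of the image. *)
Require Import Defs.
From mathcomp Require Import all_boot all_order all_algebra.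
From mathcomp Require Import all_classical all_reals all_analysis.
From mathcomp Require Import complex.
From mathcomp Require Import ring lra.
Set Implicit Arguments.
Unset Strict Implicit.
Unset Printing Implicit Defensive.
Import Order.TTheory GRing.Theory Num.Theory.
Import numFieldNormedType.Exports.
Local Open Scope classical_set_scope.
Local Open Scope ring_scope.

(** * The modulus of a complex number, and the topology of the plane in terms of it *)

Section Modulus.
Context {R : realType}.
Local Notation C := (R[i]).
Implicit Types (z w : C) (x : R).

(** The derivative case carries the analytic weight: [holo] asserts complex differentiability at
    each point and no continuity of the derivative, so the Cauchy estimate has to start from
    Goursat. Axis-parallel squares turn contour integrals into real integrals over segments. The
    value 2*pi*i of the integral of dw/(w - z) is never computed; a lower bound for its modulus is
    enough.

    On the weak side two mismatches shape the proof. An initial space gives compactness for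
    sequences, whereas [wcompact_op] speaks of filters; the bridge is that a holomorphic function is
    determined by its values on a countable dense set. And a weak-star neighbourhood in the bidual
    involves only finitely many functionals, so Goldstine's theorem reduces to Helly's lemma, which
    is proved here by minimising a quadratic expression over the ball, without Hahn-Banach. The
    gliding hump uses only linearity and boundedness of a functional, so no description of the dual
    of the target space is called for. *)

Lemma cabsE z : cabs z = Num.sqrt (complex.Re z ^+ 2 + complex.Im z ^+ 2).
Proof. by case: z. Qed.

Lemma normcE_cabs z : `|z| = ((cabs z)%:C)%C.
Proof. by case: z. Qed.

Lemma cabs_ge0 z : 0 <= cabs z.
Proof. by rewrite cabsE sqrtr_ge0. Qed.

Lemma cabsM z w : cabs (z * w) = cabs z * cabs w.
Proof. exact: Normc.normcM. Qed.

Lemma cabsV z : cabs z^-1 = (cabs z)^-1.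
Proof. exact: Normc.normcV. Qed.

Lemma cabsD z w : cabs (z + w) <= cabs z + cabs w.
Proof. exact: le_normcD. Qed.

Lemma cabsN z : cabs (- z) = cabs z.
Proof. exact: normcN. Qed.

Lemma cabsBC z w : cabs (z - w) = cabs (w - z).
Proof. by rewrite -cabsN opprB. Qed.

Lemma cabsB z w : cabs (z - w) <= cabs z + cabs w.
Proof. by rewrite -(cabsN w) cabsD. Qed.

Lemma cabs0 : cabs (0 : C) = 0.
Proof. exact: Normc.normc0. Qed.

Lemma cabs0_eq0 z : cabs z = 0 -> z = 0.
Proof. exact: Normc.eq0_normc. Qed.

Lemma cabs_gt0 z : (0 < cabs z) = (z != 0).
Proof.
rewrite lt_neqAle cabs_ge0 andbT; apply/idP/idP; apply: contra => /eqP.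
  by move=> ->; rewrite cabs0.
by move=> /esym/cabs0_eq0 ->.
Qed.

Lemma cabsR x : cabs (x%:C)%C = `|x|.
Proof. by rewrite cabsE /= expr0n addr0 sqrtr_sqr. Qed.

Lemma cabs1 : cabs (1 : C) = 1.
Proof. exact: Normc.normc1. Qed.

Lemma cabs_geRe z : `|complex.Re z| <= cabs z.
Proof.
by rewrite cabsE -sqrtr_sqr ler_wsqrtr // lerDl sqr_ge0.
Qed.

Lemma cabs_geIm z : `|complex.Im z| <= cabs z.
Proof.
by rewrite cabsE -sqrtr_sqr ler_wsqrtr // lerDr sqr_ge0.
Qed.

Lemma cabs_leReIm z : cabs z <= `|complex.Re z| + `|complex.Im z|.
Proof.
rewrite cabsE -[leRHS]ger0_norm ?addr_ge0 // -sqrtr_sqr ler_wsqrtr //.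
by rewrite sqrrD !real_normK ?num_real //; have := mulr_ge0 (normr_ge0 (complex.Re z)) (normr_ge0 (complex.Im z)); lra.
Qed.

Lemma ReD z w : complex.Re (z + w) = complex.Re z + complex.Re w.
Proof. by case: z; case: w. Qed.
Lemma ReB z w : complex.Re (z - w) = complex.Re z - complex.Re w.
Proof. by case: z; case: w. Qed.
Lemma ImB z w : complex.Im (z - w) = complex.Im z - complex.Im w.
Proof. by case: z; case: w. Qed.

Lemma ltr_cabs z x : (`|z| < (x%:C)%C) = (cabs z < x).
Proof. by rewrite normcE_cabs ltcR. Qed.

(** Balls of [C^o] have radii in [R[i]], positive for its partial order and hence real; with this
    equivalence all later estimates can be made with real radii. *)
Lemma nbhs_cabsP (z : C^o) (P : set C^o) :
  nbhs z P <-> exists2 d : R, 0 < d & forall w, cabs (w - z) < d -> P w.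
Proof.
rewrite nbhs_nearE; split.
  move=> /nbhs_normP [e /= e0 eP]; exists (complex.Re e).
    by move: e0; rewrite ltcE /= => /andP[].
  move=> w wz; apply: eP => /=; rewrite distrC normcE_cabs ltcE /= wz andbT.
  by move: e0; rewrite ltcE /= => /andP[].
move=> [d d0 dP]; apply/nbhs_normP; exists (d%:C)%C => /=; first by rewrite ltcR.
by move=> w /=; rewrite ltr_cabs cabsBC; exact: dP.
Qed.

Lemma cont_cabsP (f : C^o -> C^o) (z : C^o) :
  {for z, continuous f} <->
  forall e : R, 0 < e -> exists2 d : R, 0 < d &
    forall w, cabs (w - z) < d -> cabs (f w - f z) < e.
Proof.
split=> [fz e e0|H].
  have /fz/nbhs_cabsP[d d0 dP] : nbhs (f z) [set w | cabs (w - f z) < e].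
    by apply/nbhs_cabsP; exists e.
  by exists d.
move=> A /nbhs_cabsP [e e0 eA]; apply/nbhs_cabsP.
by have [d d0 dP] := H e e0; exists d => // w /dP /eA.
Qed.

Lemma derivable_expansion (f : C^o -> C^o) (z : C^o) : derivable f z 1 ->
  forall e : R, 0 < e -> exists2 d : R, 0 < d &
    forall w, cabs (w - z) < d ->
    cabs (f w - f z - 'D_1 f z * (w - z)) <= e * cabs (w - z).
Proof.
move=> fz e e0.
have /cvgrPdist_le /(_ (e%:C)%C) := fz; rewrite -/(derive f z 1).
rewrite ltcR => /(_ e0); rewrite near_withinE => /nbhs_cabsP[d d0 dP].
exists d => // w wd; have [->|wz] := eqVneq w z.
  by rewrite !subrr mulr0 subrr cabs0 mulr0.
have wz0 : w - z != 0 by rewrite subr_eq0.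
have := dP (w - z); rewrite subr0 => /(_ wd wz0).
rewrite /= normcE_cabs lecR.
rewrite -[(w - z)^-1 *: _]/((w - z)^-1 * _) -[(w - z)%:A]/((w - z) * 1) mulr1 subrK.
rewrite cabsBC -(ler_pM2r (x := cabs (w - z))) ?cabs_gt0 // -cabsM.
by rewrite mulrBl mulrAC mulVf // mul1r.
Qed.

Lemma derivable_cont (f : C^o -> C^o) (z : C^o) :
  derivable f z 1 -> {for z, continuous f}.
Proof. by move=> /derivable1_diffP; exact: differentiable_continuous. Qed.

(** The disc is a closed subset of the image of the real square [-r, r]^2 under the continuous map
    (p, q) -> p + iq. *)
Lemma compact_cdisk (r : R) : compact ([set z : C^o | cabs z <= r]).
Proof.
pose f (p : R^o * R^o) : C^o := (p.1 +i* p.2)%C.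
have cf : continuous f.
  move=> p A /nbhs_cabsP [e e0 eA].
  have e2 : 0 < e / 2 by lra.
  exists ([set x | `|p.1 - x| < e / 2], [set x | `|p.2 - x| < e / 2]) => /=.
    by split; apply: nbhsx_ballx.
  move=> q [/= q1 q2]; apply: eA; apply: (le_lt_trans (cabs_leReIm _)).
  by rewrite /f ReB ImB /= distrC (distrC q.2); lra.
apply: (@subclosed_compact _ _ (f @` (`[- r, r]%classic `*` `[- r, r]%classic))).
- rewrite -[X in closed X]setCK; apply: open_closedC.
  rewrite openE => z /= /negP; rewrite -ltNge => rz; apply/nbhs_cabsP.
  exists (cabs z - r); first by rewrite subr_gt0.
  move=> w wz /=; apply/negP; rewrite -ltNge.
  by have := cabsD w (z - w); rewrite subrKC cabsBC; lra.
- apply: continuous_compact; first exact: continuous_subspaceT.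
  by apply: compact_setX; exact: segment_compact.
- move=> z /= zr; exists (complex.Re z, complex.Im z) => /=; last by case: z {zr}.
  by split; rewrite /= in_itv /= -ler_norml (le_trans _ zr) // ?cabs_geRe ?cabs_geIm.
Qed.

Lemma cont_bounded_cdisk (f : C^o -> C^o) (r : R) :
  (forall z, cabs z <= r -> {for z, continuous f}) ->
  exists2 B : R, 0 <= B & forall z, cabs z <= r -> cabs (f z) <= B.
Proof.
move=> cf.
have : compact ((fun z : C^o => cabs (f z) : R^o) @` [set z : C^o | cabs z <= r]).
  apply: continuous_compact; last exact: compact_cdisk.
  apply: continuous_in_subspaceT => z /set_mem /= /cf /cont_cabsP cfz.
  move=> A /nbhs_ballP[e e0 eA]; apply/nbhs_cabsP.
  have [d d0 dP] := cfz e e0; exists d => // w /dP h; apply: eA.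
  rewrite /ball /=; apply: le_lt_trans h.
  have := cabsD (f w) (f z - f w); rewrite subrKC cabsBC => h1.
  have := cabsD (f z) (f w - f z); rewrite subrKC => h2.
  by rewrite ler_norml; lra.
move=> /compact_bounded[M [_ MP]]; exists (`|M| + 1); first by have := normr_ge0 M; lra.
move=> z zr; have M1 : M < `|M| + 1 by have := ler_norm M; lra.
apply: le_trans (ler_norm _) _; apply: (MP _ M1 (cabs (f z))).
by exists z.
Qed.

End Modulus.

(** * Integrals of complex-valued functions over real segments *)

Section SegmentIntegral.
Context {R : realType}.
Local Notation C := (R[i]).
Local Notation mu := (@lebesgue_measure R).
Implicit Types (a b c : R) (phi psi : R -> C).

Definition cint a b phi : C :=
  (Rintegral mu `[a, b] (@complex.Re R \o phi) +i*
   Rintegral mu `[a, b] (@complex.Im R \o phi))%C.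

(** Two-sided continuity is required at the end points as well, so that the condition passes to
    subsegments at once. *)
Definition ccont a b phi := forall t, a <= t <= b ->
  {for t, continuous (@complex.Re R \o phi : R^o -> R^o)} /\
  {for t, continuous (@complex.Im R \o phi : R^o -> R^o)}.

Lemma ccont_sub a b c d phi : a <= c -> d <= b -> ccont a b phi -> ccont c d phi.
Proof. by move=> ac db h t td; apply: h; lra. Qed.

Lemma ccont_intRe a b phi : ccont a b phi ->
  mu.-integrable `[a, b] (EFin \o (@complex.Re R \o phi)).
Proof.
move=> h; apply: continuous_compact_integrable; first exact: segment_compact.
apply: continuous_in_subspaceT => t /set_mem /=; rewrite in_itv /= => tab.
exact: (h t tab).1.
Qed.

Lemma ccont_intIm a b phi : ccont a b phi ->
  mu.-integrable `[a, b] (EFin \o (@complex.Im R \o phi)).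
Proof.
move=> h; apply: continuous_compact_integrable; first exact: segment_compact.
apply: continuous_in_subspaceT => t /set_mem /=; rewrite in_itv /= => tab.
exact: (h t tab).2.
Qed.

Lemma eq_cint a b phi psi : (forall t, a <= t <= b -> phi t = psi t) ->
  cint a b phi = cint a b psi.
Proof.
by move=> h; congr (_ +i* _)%C; apply: eq_Rintegral => t /set_mem /=;
  rewrite in_itv /= => /h ->.
Qed.

Lemma cintB a b phi psi : ccont a b phi -> ccont a b psi ->
  cint a b (fun t => phi t - psi t) = cint a b phi - cint a b psi.
Proof.
move=> cphi cpsi; apply/eqP; rewrite eq_complex /= -!RintegralB //;
  do ?[exact: ccont_intRe|exact: ccont_intIm].
by apply/andP; split; apply/eqP; apply: eq_Rintegral => t _ /=; rewrite (ReB, ImB).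
Qed.

Lemma cintZ a b (k : C) phi : ccont a b phi ->
  cint a b (fun t => k * phi t) = k * cint a b phi.
Proof.
move=> cphi; apply/eqP; have iR := ccont_intRe cphi; have iI := ccont_intIm cphi.
have iRZ (r : R) : mu.-integrable `[a, b] (EFin \o (fun t => r * (@complex.Re R \o phi) t)).
  apply: eq_integrable (integrableZl _ r iR) => //.
have iIZ (r : R) : mu.-integrable `[a, b] (EFin \o (fun t => r * (@complex.Im R \o phi) t)).
  apply: eq_integrable (integrableZl _ r iI) => //.
case: k => p q; rewrite eq_complex /= -!RintegralZl // -RintegralB // -RintegralD //.
by apply/andP; split; apply/eqP; apply: eq_Rintegral => t _ /=; case: (phi t).
Qed.

Lemma Rintegral_cst_itv a b (r : R) : a <= b ->
  Rintegral mu `[a, b] (fun=> r) = (b - a) * r.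
Proof.
move=> ab; rewrite Rintegral_cst //= lebesgue_measure_itv /= lte_fin mulrC.
by case: ltP => //= ba; rewrite (le_anti (_ : a <= b <= a)) ?ab // subrr.
Qed.

Lemma cint_cst a b (k : C) : a <= b -> cint a b (fun=> k) = ((b - a)%:C)%C * k.
Proof.
by move=> ab; rewrite /cint !Rintegral_cst_itv //; case: k => p q; simpc.
Qed.

Lemma Rintegral_split a b c f : a <= c <= b ->
  mu.-integrable `[a, b] (EFin \o f) ->
  Rintegral mu `[a, b] f = Rintegral mu `[a, c] f + Rintegral mu `[c, b] f.
Proof.
move=> /andP[ac cb] fi.
have := @Rintegral_itvB R f (BLeft a) (BRight b) c fi.
rewrite !bnd_simp => /(_ ac cb); rewrite Rintegral_itv_obnd_cbnd //.
  by move=> <-; rewrite addrC subrK.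
by apply: integrableS fi => //; apply: subset_itvr; rewrite bnd_simp.
Qed.

Lemma cint_split a b c phi : a <= c <= b -> ccont a b phi ->
  cint a b phi = cint a c phi + cint c b phi.
Proof.
move=> acb h; apply/eqP; rewrite eq_complex /=.
by rewrite -!Rintegral_split ?eqxx //; [exact: ccont_intIm|exact: ccont_intRe].
Qed.

Lemma Rintegral_bound a b f (B : R) : a <= b ->
  mu.-integrable `[a, b] (EFin \o f) ->
  (forall t, a <= t <= b -> `|f t| <= B) ->
  `|Rintegral mu `[a, b] f| <= B * (b - a).
Proof.
move=> ab fi fB; apply: le_trans (le_normr_Rintegral _ fi) _ => //.
rewrite mulrC -Rintegral_cst_itv //; apply: le_Rintegral => //.
- exact: (integrable_norm fi).
- have := @continuous_compact_integrable R (fun=> B) `[a, b] (@segment_compact _ _ _).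
  by apply; apply: continuous_subspaceT => x; exact: cvg_cst.
Qed.

(** The factor 2 is the price of bounding the real and imaginary parts separately; the later
    arguments have room for it. *)
Lemma cint_bound a b phi (B : R) : a <= b -> ccont a b phi ->
  (forall t, a <= t <= b -> cabs (phi t) <= B) ->
  cabs (cint a b phi) <= 2 * B * (b - a).
Proof.
move=> ab cphi phiB; apply: le_trans (cabs_leReIm _) _ => /=.
rewrite -mulrA mulr2n mulrDl mul1r; apply: lerD; apply: Rintegral_bound => //.
- exact: ccont_intRe.
- by move=> t /phiB; apply: le_trans; exact: cabs_geRe.
- exact: ccont_intIm.
- by move=> t /phiB; apply: le_trans; exact: cabs_geIm.
Qed.

(** Intended for 1/(w - z): its differences between opposite sides of a square centred at z are
    purely imaginary, up to a factor -i for the vertical pair. *)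
Lemma cint_realI_ge a b (k : R -> R) (m : R) : a <= b ->
  (forall t, a <= t <= b -> {for t, continuous (k : R^o -> R^o)}) ->
  (forall t, a <= t <= b -> m <= k t) ->
  exists2 r : R, m * (b - a) <= r & cint a b (fun t => (0 +i* k t)%C) = (0 +i* r)%C.
Proof.
move=> ab ck km; exists (Rintegral mu `[a, b] k); last first.
  rewrite /cint; congr (_ +i* _)%C.
  rewrite (@eq_Rintegral _ _ _ _ _ (fun=> 0)) ?Rintegral_cst_itv ?mulr0 //.
rewrite mulrC -Rintegral_cst_itv //; apply: le_Rintegral => //.
- have := @continuous_compact_integrable R (fun=> m) `[a, b] (@segment_compact _ _ _).
  by apply; apply: continuous_subspaceT => x; exact: cvg_cst.
- apply: continuous_compact_integrable; first exact: segment_compact.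
  by apply: continuous_in_subspaceT => t /set_mem /=; rewrite in_itv; exact: ck.
Qed.

End SegmentIntegral.

(** * Contour integrals over axis-parallel squares *)

Section Squares.
Context {R : realType}.
Local Notation C := (R[i]).
Implicit Types (g : C -> C) (x y s : R).

Definition hline g x y s : C := cint x (x + s) (fun t => g (t +i* y)%C).
Definition vline g x y s : C := cint y (y + s) (fun t => g (x +i* t)%C).

(** The counterclockwise contour integral over the square with lower left corner x + iy and side s:
    dw is dt on horizontal sides and i dt on vertical ones. *)
Definition sqint g x y s : C :=
  hline g x y s - hline g x (y + s) s
  + 'i%C * (vline g (x + s) y s - vline g x y s).

Definition square x y s : set C :=
  [set w | (x <= complex.Re w <= x + s) /\ (y <= complex.Im w <= y + s)].

Definition sqbd x y s : set C := [set w | square x y s w /\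
  [\/ complex.Re w = x, complex.Re w = x + s,
      complex.Im w = y | complex.Im w = y + s]].

Definition cont_on (A : set C) g := forall w : C^o, A w -> {for w, continuous (g : C^o -> C^o)}.

Lemma cont_at_hline g x y : {for (x +i* y)%C : C^o, continuous (g : C^o -> C^o)} ->
  {for x, continuous (@complex.Re R \o (fun t => g (t +i* y)%C) : R^o -> R^o)} /\
  {for x, continuous (@complex.Im R \o (fun t => g (t +i* y)%C) : R^o -> R^o)}.
Proof.
move=> /cont_cabsP cg; split; apply/cvgrPdist_lt => e e0;
  have [d d0 dP] := cg e e0; apply/nbhs_ballP; exists d => // t;
  rewrite /ball /= => td.
all: have := dP (t +i* y)%C; rewrite cabsE /= subrr expr0n addr0 sqrtr_sqr.
all: move=> /(_ _); rewrite distrC => /(_ td); apply: le_lt_trans; rewrite distrC.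
- by rewrite -ReB cabs_geRe.
- by rewrite -ImB cabs_geIm.
Qed.

Lemma cont_at_vline g x y : {for (x +i* y)%C : C^o, continuous (g : C^o -> C^o)} ->
  {for y, continuous (@complex.Re R \o (fun t => g (x +i* t)%C) : R^o -> R^o)} /\
  {for y, continuous (@complex.Im R \o (fun t => g (x +i* t)%C) : R^o -> R^o)}.
Proof.
move=> /cont_cabsP cg; split; apply/cvgrPdist_lt => e e0;
  have [d d0 dP] := cg e e0; apply/nbhs_ballP; exists d => // t;
  rewrite /ball /= => td.
all: have := dP (x +i* t)%C; rewrite cabsE /= subrr expr0n add0r sqrtr_sqr.
all: move=> /(_ _); rewrite distrC => /(_ td); apply: le_lt_trans; rewrite distrC.
- by rewrite -ReB cabs_geRe.
- by rewrite -ImB cabs_geIm.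
Qed.

Lemma ccont_hline g x y s :
  (forall t, x <= t <= x + s -> {for (t +i* y)%C : C^o, continuous (g : C^o -> C^o)}) ->
  ccont x (x + s) (fun t => g (t +i* y)%C).
Proof. by move=> h t /h/cont_at_hline. Qed.

Lemma ccont_vline g x y s :
  (forall t, y <= t <= y + s -> {for (x +i* t)%C : C^o, continuous (g : C^o -> C^o)}) ->
  ccont y (y + s) (fun t => g (x +i* t)%C).
Proof. by move=> h t /h/cont_at_vline. Qed.

Lemma sqbd_lines x y s t : 0 <= s ->
  (x <= t <= x + s -> sqbd x y s (t +i* y)%C /\ sqbd x y s (t +i* (y + s))%C) /\
  (y <= t <= y + s -> sqbd x y s (x +i* t)%C /\ sqbd x y s ((x + s) +i* t)%C).
Proof.
move=> s0; split=> h; split; split; rewrite /square /=; try lra.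
- by constructor 3.
- by constructor 4.
- by constructor 1.
- by constructor 2.
Qed.

Lemma ccont_sqbd g x y s : 0 <= s -> cont_on (sqbd x y s) g ->
  [/\ ccont x (x + s) (fun t => g (t +i* y)%C),
      ccont x (x + s) (fun t => g (t +i* (y + s))%C),
      ccont y (y + s) (fun t => g (x +i* t)%C) &
      ccont y (y + s) (fun t => g ((x + s) +i* t)%C)].
Proof.
move=> s0 cg; split; [apply: ccont_hline|apply: ccont_hline|apply: ccont_vline|
  apply: ccont_vline] => t ht; apply: cg; have [h v] := sqbd_lines x y t s0;
  by [have [] := h ht|have [] := v ht].
Qed.

Lemma sqintB g h x y s : 0 <= s -> cont_on (sqbd x y s) g -> cont_on (sqbd x y s) h ->
  sqint (fun w => g w - h w) x y s = sqint g x y s - sqint h x y s.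
Proof.
move=> s0 /(ccont_sqbd s0)[? ? ? ?] /(ccont_sqbd s0)[? ? ? ?].
by rewrite /sqint /hline /vline !cintB //; ring.
Qed.

Lemma sqintZ (k : C) g x y s : 0 <= s -> cont_on (sqbd x y s) g ->
  sqint (fun w => k * g w) x y s = k * sqint g x y s.
Proof.
move=> s0 /(ccont_sqbd s0)[? ? ? ?].
by rewrite /sqint /hline /vline !cintZ //; ring.
Qed.

(** The constant 8 is four sides times the factor 2 of [cint_bound]. *)
Lemma sqint_bound g x y s (B : R) : 0 <= s -> cont_on (sqbd x y s) g ->
  (forall w, sqbd x y s w -> cabs (g w) <= B) ->
  cabs (sqint g x y s) <= 8 * B * s.
Proof.
move=> s0 cg gB; have [c1 c2 c3 c4] := ccont_sqbd s0 cg.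
have ci : cabs ('i%C : C) = 1 by rewrite cabsE /= expr0n add0r expr1n sqrtr1.
have xs : x <= x + s by lra.
have ys : y <= y + s by lra.
have b1 : cabs (hline g x y s) <= 2 * B * (x + s - x).
  by apply: cint_bound => // t ht; apply: gB; case: (sqbd_lines x y t s0) => /(_ ht)[].
have b2 : cabs (hline g x (y + s) s) <= 2 * B * (x + s - x).
  by apply: cint_bound => // t ht; apply: gB; case: (sqbd_lines x y t s0) => /(_ ht)[].
have b3 : cabs (vline g x y s) <= 2 * B * (y + s - y).
  by apply: cint_bound => // t ht; apply: gB; case: (sqbd_lines x y t s0) => _ /(_ ht)[].
have b4 : cabs (vline g (x + s) y s) <= 2 * B * (y + s - y).
  by apply: cint_bound => // t ht; apply: gB; case: (sqbd_lines x y t s0) => _ /(_ ht)[].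
rewrite /sqint; apply: le_trans (cabsD _ _) _; rewrite cabsM ci mul1r.
have := cabsB (hline g x y s) (hline g x (y + s) s).
have := cabsB (vline g (x + s) y s) (vline g x y s).
by lra.
Qed.

Lemma cont_affine (al be : C) : continuous ((fun w => al + be * w) : C^o -> C^o).
Proof.
move=> w; apply/cont_cabsP => e e0; have b0 := cabs_ge0 be.
exists (e / (cabs be + 1)); first by rewrite divr_gt0 //; lra.
move=> u; rewrite ltr_pdivlMr; last by lra.
have -> : al + be * u - (al + be * w) = be * (u - w) by ring.
by rewrite cabsM; have := cabs_ge0 (u - w); nra.
Qed.

(** Between opposite sides the integrand differs by a constant, [be] times is or [be] times s, and
    the two resulting contributions cancel. *)
Lemma sqint_affine (al be : C) x y s : 0 <= s -> sqint (fun w => al + be * w) x y s = 0.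
Proof.
move=> s0; have cg : cont_on (sqbd x y s) (fun w => al + be * w).
  by move=> w _; exact: cont_affine.
have [c1 c2 c3 c4] := ccont_sqbd s0 cg.
rewrite /sqint /hline /vline -!cintB //.
rewrite (@eq_cint _ x _ _ (fun=> - be * (0 +i* s)%C)); last first.
  move=> t _; have -> : (t +i* (y + s))%C = (t +i* y)%C + (0 +i* s)%C.
    by rewrite /GRing.add /= addr0.
  by ring.
rewrite (@eq_cint _ y _ _ (fun=> be * (s +i* 0)%C)); last first.
  move=> t _; have -> : ((x + s) +i* t)%C = (x +i* t)%C + (s +i* 0)%C.
    by rewrite /GRing.add /= addr0.
  by ring.
rewrite !cint_cst ?lerDl // (addrC x) (addrC y) !addrK.
have -> : (0 +i* s)%C = 'i%C * (s%:C)%C :> C by simpc.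
have -> : (s +i* 0)%C = (s%:C)%C :> C by [].
by ring.
Qed.

(* The centre is excluded so that the lemma applies to integrands that are
   singular there: no side of the nine squares passes through it. *)
Lemma sqint_split9 g x y s : 0 < s ->
  (forall w : C^o, square x y (3 * s) w ->
     w != ((x + 3 / 2 * s) +i* (y + 3 / 2 * s))%C ->
     {for w, continuous (g : C^o -> C^o)}) ->
  sqint g x y (3 * s) =
  \sum_(i < 3) \sum_(j < 3) sqint g (x + i%:R * s) (y + j%:R * s) s.
Proof.
move=> s0 cg.
have cgh (j : nat) : (j < 4)%N -> ccont x (x + 3 * s) (fun t => g (t +i* (y + j%:R * s))%C).
  move=> j4; apply: ccont_hline => t ht; apply: cg.
    by move: j4; do 4?[case: j => [|j]] => //= _; rewrite /square /=; lra.
  rewrite eq_complex negb_and /=; apply/orP; right; apply/eqP.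
  by move: j4; do 4?[case: j => [|j]] => //= _; lra.
have cgv (j : nat) : (j < 4)%N -> ccont y (y + 3 * s) (fun t => g ((x + j%:R * s) +i* t)%C).
  move=> j4; apply: ccont_vline => t ht; apply: cg.
    by move: j4; do 4?[case: j => [|j]] => //= _; rewrite /square /=; lra.
  rewrite eq_complex negb_and /=; apply/orP; left; apply/eqP.
  by move: j4; do 4?[case: j => [|j]] => //= _; lra.
have split3 (phi : R -> C) (u : R) : ccont u (u + 3 * s) phi ->
  cint u (u + 3 * s) phi = cint u (u + s) phi + cint (u + s) (u + s + s) phi
    + cint (u + 2 * s) (u + 2 * s + s) phi.
  move=> cphi; rewrite (@cint_split _ _ _ (u + 2 * s)) //; last by lra.
  rewrite (@cint_split _ u _ (u + s)) //; first last.
  - by apply: ccont_sub cphi; lra.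
  - by lra.
  by congr (_ + cint _ _ _ + cint _ _ _); ring.
rewrite !big_ord_recl !big_ord0 /= /bump /= !addr0 !mul0r !addr0 !mul1r /sqint /hline /vline.
have := (cgh 0%N isT, cgh 1%N isT, cgh 2%N isT, cgh 3%N isT).
have := (cgv 0%N isT, cgv 1%N isT, cgv 2%N isT, cgv 3%N isT).
rewrite !mul0r !addr0 !mul1r => -[[[v0 v1] v2] v3] [[[h0 h1] h2] h3].
rewrite !(split3 _ _ v0, split3 _ _ v3, split3 _ _ h0, split3 _ _ h3).
have e2 u : u + s + s = u + 2 * s by ring.
have e3 u : u + 2 * s + s = u + 3 * s by ring.
by rewrite !(e2, e3) -?[1 + 1]/(2%:R); ring.
Qed.

End Squares.

(** * Goursat's lemma for squares *)

Section Goursat.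
Context {R : realType}.
Local Notation C := (R[i]).
Implicit Types (g f : C -> C) (x y s : R).

Lemma nested_point (a b : nat -> R) : (forall n, a n <= a n.+1) ->
  (forall n, b n.+1 <= b n) -> (forall n, a n <= b n) ->
  exists c, forall n, a n <= c <= b n.
Proof.
move=> ha hb ab.
have am : {homo a : m n / (m <= n)%N >-> m <= n} by apply: homo_leq => // ? ? ?; apply: le_trans.
have bm : {homo b : m n / (m <= n)%N >-> n <= m}.
  by apply: (homo_leq (r := fun u v => v <= u)) => // u v w /[swap]; apply: le_trans.
have aub m : ubound (range a) (b m).
  move=> _ [n _ <-]; apply: le_trans (am _ _ (leq_maxl n m)) _.
  by apply: le_trans (ab _) _; apply: bm; exact: leq_maxr.
exists (sup (range a)) => n; apply/andP; split.
  by apply: ub_le_sup; [exists (b 0%N); exact: aub|exists n].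
by apply: ge_sup; [exists (a 0%N), 0%N|exact: aub].
Qed.

Lemma geometric_small s (e : R) : 0 < s -> 0 < e -> exists n, s / 3 ^+ n < e.
Proof.
move=> s0 e0; have se0 : 0 <= s / e by rewrite ltW // divr_gt0.
exists (Num.bound (s / e)); rewrite ltr_pdivrMr ?exprn_gt0 //.
have := archi_boundP se0; rewrite ltr_pdivrMr // => /lt_le_trans; apply.
rewrite mulrC ler_wpM2l ?(ltW e0) //.
by rewrite -natrX ler_nat ltnW // ltn_expl.
Qed.

Lemma square_sub x y s x' y' s' : x <= x' -> x' + s' <= x + s ->
  y <= y' -> y' + s' <= y + s -> square x' y' s' `<=` square x y s.
Proof. by move=> ? ? ? ? w [? ?]; split; lra. Qed.

Lemma square_cabs x y s (w w' : C) : square x y s w -> square x y s w' ->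
  cabs (w - w') <= 2 * s.
Proof.
move=> [? ?] [? ?]; apply: le_trans (cabs_leReIm _) _; rewrite ReB ImB.
have -> : 2 * s = s + s by ring.
by apply: lerD; rewrite ler_norml; lra.
Qed.

(** Each of the nine subsquares has a ninth of the area; if all their integrals fell below [k] times
    their area, the sum would fall below [k] times the whole area. *)
Lemma sqint_subdivide g x y s (k : R) : 0 < s ->
  (forall w, square x y s w -> {for w : C^o, continuous (g : C^o -> C^o)}) ->
  k * s ^+ 2 <= cabs (sqint g x y s) ->
  exists x' y', [/\ x <= x', x' + s / 3 <= x + s, y <= y', y' + s / 3 <= y + s &
    k * (s / 3) ^+ 2 <= cabs (sqint g x' y' (s / 3))].
Proof.
move=> s0 cg hk; apply: contrapT => H.
have small (i j : 'I_3) :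
    cabs (sqint g (x + i%:R * (s / 3)) (y + j%:R * (s / 3)) (s / 3)) < k * (s / 3) ^+ 2.
  have i3 (m : 'I_3) : 0 <= (m%:R : R) * (s / 3) <= 2 * (s / 3).
    have m2 : (m%:R : R) <= 2 by rewrite ler_nat -ltnS ltn_ord.
    by have m0 : 0 <= (m%:R : R) by []; apply/andP; split; nra.
  rewrite ltNge; apply/negP => h; apply: H.
  have := i3 i; have := i3 j => *.
  by exists (x + i%:R * (s / 3)), (y + j%:R * (s / 3)); split => //; lra.
have e3 : 3 * (s / 3) = s by field.
move: hk; rewrite -e3 sqint_split9; first last.
- by move=> w; rewrite e3 => /cg.
- by lra.
apply/negP; rewrite -ltNge.
apply: (@lt_le_trans _ _ (\sum_(i < 3) \sum_(j < 3) (k * (s / 3) ^+ 2))).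
  rewrite !big_ord_recl !big_ord0 !addr0.
  do !(apply: le_lt_trans (cabsD _ _) _; rewrite ?ltrD //).
  all: try by apply: ltrD => //; apply: le_lt_trans (cabsD _ _) _; apply: ltrD => //; apply: le_lt_trans (cabsD _ _) _; apply: ltrD.
rewrite !sumr_const !card_ord -mulrnA e3 -[leRHS]mulr1 -mulr_natr.
by rewrite le_eqVlt; apply/orP; left; apply/eqP; field.
Qed.

(* Goursat: subdivision produces nested squares on which the integral is at
   least a fixed multiple of the area, contradicting the first-order expansion
   of g at their common point, since affine functions integrate to 0. *)
Lemma goursat_square g x y s : 0 < s ->
  (forall w : C^o, square x y s w -> derivable (g : C^o -> C^o) w 1) ->
  sqint g x y s = 0.
Proof.
move=> s0 dg; apply: cabs0_eq0; apply/eqP; apply: contraT => J0.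
have {}J0 : 0 < cabs (sqint g x y s) by rewrite lt_neqAle cabs_ge0 eq_sym J0.
pose k := cabs (sqint g x y s) / s ^+ 2.
have k0 : 0 < k by rewrite divr_gt0 // exprn_gt0.
pose K (p : R * R * R) := [/\ 0 < p.2, square p.1.1 p.1.2 p.2 `<=` square x y s &
  k * p.2 ^+ 2 <= cabs (sqint g p.1.1 p.1.2 p.2)].
(* The implication sits under the existential so that [choice] yields a total map on triples, which
   can be iterated. *)
have step p : exists p', K p -> [/\ K p', p'.2 = p.2 / 3 &
    [/\ p.1.1 <= p'.1.1, p'.1.1 + p'.2 <= p.1.1 + p.2,
        p.1.2 <= p'.1.2 & p'.1.2 + p'.2 <= p.1.2 + p.2]].
  have [Kp|nKp] := pselect (K p); last by exists p.
  case: p Kp => [[a b] t] [/= t0 sub hk].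
  have [|a' [b' [h1 h2 h3 h4 h5]]] := sqint_subdivide t0 _ hk.
    by move=> w /sub /dg/derivable_cont.
  exists (a', b', t / 3) => _; split => //; split => //=; first by lra.
  exact: subset_trans (square_sub h1 h2 h3 h4) sub.
have [F FP] := choice step.
pose u n := iter n F (x, y, s).
have Ku n : K (u n).
  elim: n => [|n IH] /=; last by have [] := FP _ IH.
  by split => //=; rewrite /k divfK // gt_eqF // exprn_gt0.
have us n : (u n).2 = s / 3 ^+ n.
  elim: n => [|n IH]; first by rewrite expr0 divr1.
  by have [_ /= -> _] := FP _ (Ku n); rewrite IH exprSr invfM mulrA.
have s0n n : 0 < (u n).2 by have [] := Ku n.
have [a aP] : exists a, forall n, (u n).1.1 <= a <= (u n).1.1 + (u n).2.
  apply: nested_point => n; last by have := s0n n; lra.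
    by have [_ _ []] := FP _ (Ku n).
  by have [_ _ []] := FP _ (Ku n).
have [b bP] : exists b, forall n, (u n).1.2 <= b <= (u n).1.2 + (u n).2.
  apply: nested_point => n; last by have := s0n n; lra.
    by have [_ _ []] := FP _ (Ku n).
  by have [_ _ []] := FP _ (Ku n).
pose w0 : C := (a +i* b)%C.
have w0P n : square (u n).1.1 (u n).1.2 (u n).2 w0 by split; [exact: aP|exact: bP].
have dw0 : derivable (g : C^o -> C^o) w0 1.
  by apply: dg; have [_ + _] := Ku 0%N; apply; exact: w0P.
(* Any denominator above 16 works: 8 comes from [sqint_bound] and 2 from the diameter estimate
   [square_cabs]. *)
have k17 : 0 < k / 17 by lra.
have [d d0 dP] := derivable_expansion dw0 k17.
have [n sn] : exists n, s / 3 ^+ n < d / 2 by apply: geometric_small => //; lra.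
move: sn; rewrite -us => sn; have [t0 sub hk] := Ku n.
pose D : C := cderiv g w0.
have {}dP w : cabs (w - w0) < d ->
  cabs (g w - g w0 - D * (w - w0)) <= k / 17 * cabs (w - w0) := dP w.
set t := (u n).2 in t0 sub hk sn *.
have h (w : C) : sqbd (u n).1.1 (u n).1.2 t w ->
    cabs (g w - ((g w0 - D * w0) + D * w)) <= k / 17 * (2 * t).
  move=> [wn _]; have ww := square_cabs wn (w0P n).
  have -> : g w - ((g w0 - D * w0) + D * w) = g w - g w0 - D * (w - w0) by ring.
  apply: le_trans (dP _ _) _; first by lra.
  by rewrite ler_pM2l.
have cgb : cont_on (sqbd (u n).1.1 (u n).1.2 t) g.
  by move=> w [/sub/dg/derivable_cont].
have cab : cont_on (sqbd (u n).1.1 (u n).1.2 t) (fun w => (g w0 - D * w0) + D * w).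
  by move=> w _; exact: cont_affine.
have cb : cont_on (sqbd (u n).1.1 (u n).1.2 t) (fun w => g w - ((g w0 - D * w0) + D * w)).
  by move=> w wb; exact: (continuousB (cgb w wb) (cab w wb)).
have := sqint_bound (ltW t0) cb h.
rewrite (sqintB (ltW t0) cgb cab) (sqint_affine _ _ _ _ (ltW t0)) subr0 => /(le_trans hk).
have -> : 8 * (k / 17 * (2 * t)) * t = 16 / 17 * (k * t ^+ 2) by field.
have : 0 < k * t ^+ 2 by rewrite mulr_gt0 // exprn_gt0.
by lra.
Qed.

End Goursat.

(** * The Cauchy estimate, by way of an isolated singularity *)

Section CauchyEstimate.
Context {R : realType}.
Local Notation C := (R[i]).
Implicit Types (g f : C -> C) (x y s : R) (z w : C).

(** Squares centred at z, with s half the side. *)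
Definition csquare z s : set C := square (complex.Re z - s) (complex.Im z - s) (2 * s).
Definition csqbd z s : set C := sqbd (complex.Re z - s) (complex.Im z - s) (2 * s).
Definition csqint g z s : C := sqint g (complex.Re z - s) (complex.Im z - s) (2 * s).

Lemma csquare_cabs z s w : csquare z s w -> cabs (w - z) <= 2 * s.
Proof.
move=> [? ?]; apply: le_trans (cabs_leReIm _) _; rewrite ReB ImB.
have -> : 2 * s = s + s by ring.
by apply: lerD; rewrite ler_norml; lra.
Qed.

Lemma csqbd_cabs z s w : 0 <= s -> csqbd z s w -> s <= cabs (w - z).
Proof.
move=> s0 [_ h]; have := cabs_geRe (w - z); have := cabs_geIm (w - z).
rewrite ReB ImB; have := ler_norm (complex.Re w - complex.Re z).
have := ler_norm (complex.Im w - complex.Im z).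
have := ler_norm (- (complex.Im w - complex.Im z)); rewrite normrN.
have := ler_norm (- (complex.Re w - complex.Re z)); rewrite normrN.
by case: h => ->; lra.
Qed.

(** Of the nine subsquares only the middle one contains z; Goursat's lemma annihilates the other
    eight. *)
Lemma csqint_shrink g z s : 0 < s ->
  (forall w : C^o, csquare z s w -> w != z -> derivable (g : C^o -> C^o) w 1) ->
  csqint g z s = csqint g z (s / 3).
Proof.
move=> s0 dg; rewrite /csqint; case: z dg => a b dg /=.
have t0 : 0 < 2 * (s / 3) by lra.
have e3 : 2 * s = 3 * (2 * (s / 3)) by field.
rewrite e3 sqint_split9 //; last first.
  move=> w; rewrite -e3 => ws wz; apply: derivable_cont; apply: dg => //.
  by apply: contra wz => /eqP ->; apply/eqP; congr (_ +i* _)%C; field.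
have Z (i j : nat) : (i < 3)%N -> (j < 3)%N -> (i != 1%N) || (j != 1%N) ->
    sqint g (a - s + i%:R * (2 * (s / 3))) (b - s + j%:R * (2 * (s / 3))) (2 * (s / 3)) = 0.
  move=> i3 j3 ij; apply: goursat_square => // w [h1 h2]; apply: dg.
    move: i3 j3 ij h1 h2; do 3?[case: i => [|i]]; do 3?[case: j => [|j]] => //= _ _ _ h1 h2;
      split => /=; lra.
  apply/eqP => wz; move: h1 h2; rewrite wz /=.
  move: i3 j3 ij; do 3?[case: i => [|i]]; do 3?[case: j => [|j]] => //= _ _ _ h1 h2; lra.
pose o1 := Ordinal (isT : (1 < 3)%N).
rewrite (bigD1 o1) //= [X in _ + X]big1 ?addr0; last first.
  by move=> i i1; apply: big1 => j _; apply: Z => //; move: i1 => ->.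
rewrite (bigD1 o1) //= [X in _ + X]big1 ?addr0; last first.
  by move=> j j1; apply: (Z 1%N j) => //; move: j1 => ->; rewrite orbT.
rewrite mul1r.
have E c : c - s + 2 * (s / 3) = c - s / 3 by field.
by rewrite !E.
Qed.

(** The contour can be shrunk to half-side t without changing the integral; a length of order t
    against an integrand o(1/t) leaves 0 in the limit. *)
Lemma csqint_removable g z s : 0 < s ->
  (forall w : C^o, csquare z s w -> w != z -> derivable (g : C^o -> C^o) w 1) ->
  (forall e : R, 0 < e -> exists2 d : R, 0 < d &
     forall w, cabs (w - z) < d -> w != z -> cabs (g w) <= e / cabs (w - z)) ->
  csqint g z s = 0.
Proof.
move=> s0 dg hg.
have Jn n : csqint g z s = csqint g z (s / 3 ^+ n).
  elim: n => [|n ->]; first by rewrite expr0 divr1.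
  rewrite exprSr invfM mulrA; apply: csqint_shrink; first by rewrite divr_gt0 // exprn_gt0.
  move=> w [h1 h2]; apply: dg.
  have : s / 3 ^+ n <= s by rewrite ler_pdivrMr ?exprn_gt0 // ler_peMr ?exprn_ege1 ?(ltW s0) //; lra.
  by split; lra.
apply: cabs0_eq0; apply/eqP; rewrite eq_le cabs_ge0 andbT; apply/ler_addgt0Pl => e e0.
rewrite addr0; have e16 : 0 < e / 16 by lra.
have [d d0 dP] := hg _ e16.
have [n sn] : exists n, s / 3 ^+ n < d / 2 by apply: geometric_small => //; lra.
have t0 : 0 < s / 3 ^+ n by rewrite divr_gt0 // exprn_gt0.
have tles : s / 3 ^+ n <= s.
  by rewrite ler_pdivrMr ?exprn_gt0 // ler_peMr ?exprn_ege1 ?(ltW s0) //; lra.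
rewrite (Jn n); set t := s / 3 ^+ n in t0 sn tles *.
have nz w : csqbd z t w -> w != z.
  move=> /(csqbd_cabs (ltW t0)) h; apply/eqP => wz.
  by move: h; rewrite wz subrr cabs0; lra.
have -> : e = 8 * (e / 16 / t) * (2 * t) by field; lra.
apply: sqint_bound; first by lra.
  move=> w wb; apply: derivable_cont; apply: dg; last exact: nz.
  by have [[? ?] _] := wb; split; lra.
move=> w wb; have [ws _] := wb.
have h1 := csquare_cabs ws; have h2 := csqbd_cabs (ltW t0) wb.
apply: le_trans (dP w _ (nz _ wb)) _; first by lra.
by rewrite ler_pM2l // lef_pV2 // posrE; lra.
Qed.

Lemma derivable_subC (f : C^o -> C^o) (w : C^o) (c : C) :
  derivable f w 1 -> derivable ((fun u => f u - c) : C^o -> C^o) w 1.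
Proof. by move=> df; exact: (derivableB df (derivable_cst (c : C^o) w 1)). Qed.

Lemma derivable_invB z (w : C^o) : w != z ->
  derivable ((fun u => (u - z)^-1) : C^o -> C^o) w 1.
Proof.
move=> wz; apply: (@derivableV _ _ (fun u : C^o => (u - z : C^o))).
  by rewrite subr_eq0.
by apply: derivable_subC; exact: derivable_id.
Qed.

(** Each pair of opposite sides contributes i times the integral of 2s/(u^2 + s^2) over |u| <= s.
    The integrand is at least 1/s on a segment of length 2s, so each pair gives at least 2. *)
Lemma csqint_inv_ge z s : 0 < s -> 4 <= cabs (csqint (fun w => (w - z)^-1) z s).
Proof.
move=> s0; have s2 : 0 <= 2 * s by lra.
have cI : cont_on (csqbd z s) (fun w => (w - z)^-1).
  move=> w wb; apply: derivable_cont; apply: derivable_invB.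
  by rewrite -subr_eq0 -cabs_gt0; have := csqbd_cabs (ltW s0) wb; lra.
case: z cI => a b cI; have [/= c1 c2 c3 c4] := ccont_sqbd s2 cI.
rewrite /csqint /sqint /hline /vline -!cintB //=.
pose k (c t : R) := 2 * s / ((t - c) ^+ 2 + s ^+ 2).
have den c t : 0 < (t - c) ^+ 2 + s ^+ 2.
  by rewrite ltr_wpDl ?sqr_ge0 // exprn_gt0.
have ck c t : {for t, continuous (k c : R^o -> R^o)}.
  apply: cvgM; first exact: cvg_cst.
  apply: cvgV; first by rewrite gt_eqF.
  apply: cvgD; last exact: cvg_cst.
  by apply: cvgM; apply: cvgB; (exact: cvg_id || exact: cvg_cst).
have kge c t : c - s <= t <= c - s + 2 * s -> s^-1 <= k c t.
  move=> h; rewrite /k ler_pdivlMr // mulrC ler_pdivrMr //; nra.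
have leI c : c - s <= c - s + 2 * s by lra.
have [r1 r1P E1] := cint_realI_ge (leI a) (fun t _ => ck a t) (kge a).
have [r2 r2P E2] := cint_realI_ge (leI b) (fun t _ => ck b t) (kge b).
have inv_i (p q : R) : (p +i* q)%C^-1 =
    ((p / (p ^+ 2 + q ^+ 2)) +i* (- q / (p ^+ 2 + q ^+ 2)))%C :> C.
  by rewrite /GRing.inv /= mulNr.
rewrite (@eq_cint _ (a - s) _ _ (fun t => (0 +i* k a t)%C)); last first.
  move=> t _; rewrite [X in (X)^-1 - _](_ : _ = ((t - a) +i* (- s))%C); last first.
    by apply/eqP; rewrite eq_complex /=; apply/andP; split; apply/eqP; ring.
  rewrite [X in _ - (X)^-1](_ : _ = ((t - a) +i* s)%C); last first.
    by apply/eqP; rewrite eq_complex /=; apply/andP; split; apply/eqP; ring.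
  rewrite !inv_i; apply/eqP; rewrite eq_complex /=; apply/andP; split; apply/eqP.
    by rewrite sqrrN subrr.
  by rewrite sqrrN /k; field; rewrite gt_eqF // den.
rewrite (@eq_cint _ (b - s) _ _ (fun t => - 'i%C * (0 +i* k b t)%C)); last first.
  move=> t _; rewrite [X in (X)^-1 - _](_ : _ = (s +i* (t - b))%C); last first.
    by apply/eqP; rewrite eq_complex /=; apply/andP; split; apply/eqP; ring.
  rewrite [X in _ - (X)^-1](_ : _ = ((- s) +i* (t - b))%C); last first.
    by apply/eqP; rewrite eq_complex /=; apply/andP; split; apply/eqP; ring.
  rewrite !inv_i; apply/eqP; rewrite eq_complex /=; apply/andP; split; apply/eqP.
    have := den b t; rewrite sqrrN /k (addrC (s ^+ 2)).
    by move: (_ + _) => q q0; field; rewrite gt_eqF.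
  by rewrite sqrrN subrr; ring.
rewrite cintZ; last first.
  move=> t _; split; last exact: ck.
  exact: cvg_cst.
rewrite E1 E2; have -> : (0 +i* r1)%C + 'i%C * (- 'i%C * (0 +i* r2)%C) = (0 +i* (r1 + r2))%C.
  by apply/eqP; rewrite eq_complex /=; apply/andP; split; apply/eqP; ring.
apply: le_trans (cabs_geIm _) => /=; apply: le_trans (ler_norm _).
have e1 c : s^-1 * (c - s + 2 * s - (c - s)) = 2 by field; lra.
by move: r1P r2P; rewrite !e1; lra.
Qed.

(** With D = f'(z), the function (f(w) - f(z))/(w - z)^2 - D/(w - z) is o(1/|w - z|) at z, so its
    contour integral vanishes. Hence D times the integral of 1/(w - z), of modulus at least 4 |D|,
    equals an integral of modulus at most 8 (2B/s^2) 2s. *)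
Lemma cauchy_estimate f z s (B : R) : 0 < s ->
  (forall w : C^o, csquare z s w -> derivable (f : C^o -> C^o) w 1) ->
  (forall w, csquare z s w -> cabs (f w) <= B) ->
  cabs (cderiv f z) <= 8 * B / s.
Proof.
move=> s0 df fB; have s2 : 0 <= 2 * s by lra.
have zs : csquare z s z by split; lra.
set D := cderiv f z.
pose G w := (f w - f z) / (w - z) ^+ 2.
pose Q w := G w - D * (w - z)^-1.
have dI (w : C^o) : w != z -> derivable ((fun w => (w - z)^-1) : C^o -> C^o) w 1.
  exact: derivable_invB.
have dG (w : C^o) : csquare z s w -> w != z -> derivable (G : C^o -> C^o) w 1.
  move=> ws wz.
  have -> : G = (fun w => f w - f z) * ((fun w => (w - z)^-1) * (fun w => (w - z)^-1)).
    by apply/funext => u; rewrite /G expr2 invfM.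
  apply: derivableM; last by apply: derivableM; exact: dI.
  by apply: derivable_subC; exact: df.
have dDI (w : C^o) : w != z -> derivable ((fun w => D * (w - z)^-1) : C^o -> C^o) w 1.
  by move=> wz; apply: derivableZ; exact: dI.
have nz w : csqbd z s w -> w != z.
  move=> /(csqbd_cabs (ltW s0)) h; apply/eqP => wz.
  by move: h; rewrite wz subrr cabs0; lra.
have Q0 : csqint Q z s = 0.
  apply: (csqint_removable s0) => [w ws wz|e e0].
    exact: (derivableB (dG w ws wz) (dDI w wz)).
  have [d d0 dP] := derivable_expansion (df z zs) e0.
  exists d => // w wd wz; have wz0 : w - z != 0 by rewrite subr_eq0.
  have -> : Q w = (f w - f z - D * (w - z)) / (w - z) ^+ 2 by rewrite /Q /G; field.
  rewrite cabsM cabsV expr2 cabsM ler_pdivrMr ?mulr_gt0 ?cabs_gt0 //.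
  rewrite mulrA divfK ?gt_eqF ?cabs_gt0 //; exact: dP.
have cG : cont_on (csqbd z s) G.
  by move=> w wb; apply: derivable_cont; apply: dG; [case: wb|exact: nz].
have cI : cont_on (csqbd z s) (fun w => (w - z)^-1).
  by move=> w wb; apply: derivable_cont; apply: dI; exact: nz.
have cDI : cont_on (csqbd z s) (fun w => D * (w - z)^-1).
  by move=> w wb; apply: derivable_cont; apply: dDI; exact: nz.
move: Q0; rewrite /csqint (sqintB s2 cG cDI) (sqintZ D s2 cI) => /subr0_eq E.
have B0 : 0 <= B by apply: le_trans (cabs_ge0 _) (fB z zs).
have : cabs (csqint G z s) <= 8 * (2 * B / s ^+ 2) * (2 * s).
  apply: (sqint_bound s2 cG) => w wb; have [ws _] := wb.
  have h := csqbd_cabs (ltW s0) wb.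
  have wz : 0 < cabs (w - z) by lra.
  rewrite cabsM cabsV expr2 cabsM; apply: ler_pM; rewrite ?cabs_ge0 ?invr_ge0 ?mulr_ge0 ?cabs_ge0 //.
    by apply: le_trans (cabsB _ _) _; have := fB _ ws; have := fB _ zs; lra.
  rewrite lef_pV2 ?posrE ?exprn_gt0 ?mulr_gt0 //; nra.
rewrite /csqint E cabsM -/(csqint _ z s) => h.
have I4 := csqint_inv_ge z s0; have D0 := cabs_ge0 D.
have : cabs D * 4 <= 8 * (2 * B / s ^+ 2) * (2 * s) by nra.
have -> : 8 * (2 * B / s ^+ 2) * (2 * s) = 4 * (8 * B / s) by field; lra.
by lra.
Qed.

End CauchyEstimate.

(** * Holomorphic functions on the disc and convergence on compact subsets *)

Section Holomorphic.
Context {R : realType}.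
Local Notation C := (R[i]).
Implicit Types (f g : C -> C) (z w : C) (r e : R).

Lemma disk0 : disk (0 : C).
Proof. by rewrite /disk /= cabs0 ltr01. Qed.

Lemma nbhs_disk (z : C^o) : disk z -> nbhs z (disk : set C^o).
Proof.
rewrite /disk /= => z1; apply/nbhs_cabsP; exists (1 - cabs z); first by lra.
by move=> w wz /=; have := cabsD z (w - z); rewrite subrKC; lra.
Qed.

Lemma holo_cont f (z : C^o) : holo f -> disk z -> {for z, continuous (f : C^o -> C^o)}.
Proof. by move=> hf dz; apply: derivable_cont; exact: hf. Qed.

Lemma holo_lin (a : C) f g : holo f -> holo g -> holo (fun z => a * f z + g z).
Proof.
by move=> hf hg z dz; exact: (derivableD (derivableZ (k := a) (hf z dz)) (hg z dz)).
Qed.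

Lemma holo_cst (c : C) : holo (fun=> c).
Proof. by move=> z _; exact: derivable_cst. Qed.

Lemma holo_sub f g : holo f -> holo g -> holo (fun z => f z - g z).
Proof.
move=> hf hg; have -> : (fun z => f z - g z) = (fun z => -1 * g z + f z).
  by apply/funext => z; ring.
exact: holo_lin.
Qed.

Lemma cderiv_lin (a : C) f g z : holo f -> holo g -> disk z ->
  cderiv (fun z => a * f z + g z) z = a * cderiv f z + cderiv g z.
Proof.
move=> hf hg dz.
have := deriveD (derivableZ (k := a) (hf z dz)) (hg z dz).
by rewrite deriveZ; last exact: hf.
Qed.

Lemma cderiv_eqD f g : eqD f g -> eqD (cderiv f) (cderiv g).
Proof.
move=> fg z dz; apply: (@near_eq_derive _ C^o C^o f g (z : C^o) 1).
by apply: filterS (nbhs_disk dz) => w; exact: fg.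
Qed.

(* The two concrete cases are point evaluation (E = id) and evaluation of the
   derivative (E = cderiv). *)
Record evaluation (E : (C -> C) -> C -> C) : Prop := Evaluation {
  ev_lin : forall (a : C) f g z, holo f -> holo g -> disk z ->
    E (fun z => a * f z + g z) z = a * E f z + E g z;
  ev_eqD : forall f g, eqD f g -> eqD (E f) (E g);
  ev_bounded : forall f r, holo f -> r < 1 ->
    exists2 B : R, 0 <= B & forall z, cabs z <= r -> cabs (E f z) <= B;
  ev_uc : forall h, (forall n, holo (h n)) -> uc_cvg h (fun=> 0) ->
    forall r e, r < 1 -> 0 < e -> exists N, forall n, (N <= n)%N ->
    forall z, cabs z <= r -> cabs (E (h n) z) < e }.

Lemma uc_cvg_cdisk h f r e : uc_cvg h f -> r < 1 -> 0 < e ->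
  exists N, forall n, (N <= n)%N -> forall z, cabs z <= r -> cabs (h n z - f z) < e.
Proof.
move=> hf r1 e0; have [] := hf [set z | cabs z <= r] (@compact_cdisk R r) _ e e0.
  by move=> z /= zr; rewrite /disk /=; lra.
by move=> N _ NP; exists N => n; exact: NP.
Qed.

Lemma evaluation_id : evaluation id.
Proof.
split=> // [f r hf r1|h hh h0 r e r1 e0].
  by apply: cont_bounded_cdisk => z zr; apply: holo_cont => //; rewrite /disk /=; lra.
have [N NP] := uc_cvg_cdisk h0 r1 e0; exists N => n Nn z zr.
by have := NP n Nn z zr; rewrite subr0.
Qed.

(** The square of half-side (r' - r)/2 about a point of |z| <= r stays within |w| <= r', its points
    being at distance at most r' - r from the centre. *)
Lemma cderiv_bound f r r' B : holo f -> r < r' -> r' < 1 ->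
  (forall z, cabs z <= r' -> cabs (f z) <= B) ->
  forall z, cabs z <= r -> cabs (cderiv f z) <= 16 * B / (r' - r).
Proof.
move=> hf rr' r'1 fB z zr; have s0 : 0 < (r' - r) / 2 by lra.
have sq w : csquare z ((r' - r) / 2) w -> cabs w <= r'.
  by move=> /csquare_cabs; have := cabsD z (w - z); rewrite subrKC; lra.
have -> : 16 * B / (r' - r) = 8 * B / ((r' - r) / 2) by field; lra.
apply: (cauchy_estimate s0) => w /sq wr; last exact: fB.
by apply: hf; rewrite /disk /=; lra.
Qed.

Lemma evaluation_cderiv : evaluation cderiv.
Proof.
split=> [|||h hh h0 r e r1 e0].
- exact: cderiv_lin.
- exact: cderiv_eqD.
- move=> f r hf r1; pose r' := (r + 1) / 2; have rr' : r < r' by rewrite /r'; lra.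
  have r'1 : r' < 1 by rewrite /r'; lra.
  have [B B0 BP] := ev_bounded evaluation_id hf r'1.
  exists (16 * B / (r' - r)); last exact: cderiv_bound.
  by apply: divr_ge0; lra.
- pose r' := (r + 1) / 2; have rr' : r < r' by rewrite /r'; lra.
  have r'1 : r' < 1 by rewrite /r'; lra.
  (* The 17 beats the constant 16 of [cderiv_bound], so that the final bound is strict. *)
  have d0 : 0 < e * (r' - r) / 17 by rewrite divr_gt0 ?mulr_gt0 //; lra.
  have [N NP] := ev_uc evaluation_id hh h0 r'1 d0; exists N => n Nn z zr.
  apply: le_lt_trans (cderiv_bound (hh n) rr' r'1 (fun z zr => ltW (NP n Nn z zr)) zr) _.
  have -> : 16 * (e * (r' - r) / 17) / (r' - r) = 16 / 17 * e by field; lra.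
  by lra.
Qed.

Lemma uc_cvg_sub h f : uc_cvg h f -> uc_cvg (fun n z => h n z - f z) (fun=> 0).
Proof.
move=> hf K cK Kd e e0; near=> n => z Kz; rewrite subr0; move: z Kz; near: n.
exact: hf.
Unshelve. all: by end_near. Qed.

Lemma uc_cvg_point h f z e : uc_cvg h f -> disk z -> 0 < e ->
  exists N, forall n, (N <= n)%N -> cabs (h n z - f z) < e.
Proof.
move=> hf dz e0; have [N NP] := uc_cvg_cdisk hf dz e0.
by exists N => n Nn; exact: NP.
Qed.

Lemma homo_ltn_ge (phi : nat -> nat) : {homo phi : m n / (m < n)%N} ->
  forall n, (n <= phi n)%N.
Proof. by move=> h; elim=> // n /leq_ltn_trans; apply; apply: h. Qed.

(* Interleaving the sequence with its limit identifies the limit of the images. *)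
Lemma intrinsic_cvg T u f : intrinsic T -> (forall n, holo (u n)) -> holo f ->
  uc_cvg u f -> uc_cvg (fun n => T (u n)) (T f).
Proof.
move=> [_ _ _ hT] hu hf uf; pose w n := if odd n then f else u n./2.
have hw n : holo (w n) by rewrite /w; case: (odd n); [exact: hf|exact: hu].
have wf : uc_cvg w f.
  move=> K cK Kd e e0; have [N _ NP] := uf K cK Kd e e0.
  exists N.*2 => // n /= Nn z Kz; rewrite /w; case: ifP => _; first by rewrite subrr cabs0.
  by apply: NP => //=; rewrite -(doubleK N) half_leq.
have [g [hg wg]] := hT w f hw hf wf.
have gT z : disk z -> g z = T f z.
  move=> dz; apply/eqP; rewrite -subr_eq0; apply/eqP; apply: cabs0_eq0.
  apply/eqP; rewrite eq_le cabs_ge0 andbT; apply/ler_addgt0Pl => e e0; rewrite addr0.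
  have [N NP] := uc_cvg_point wg dz e0.
  have := NP N.*2.+1; rewrite /w /= odd_double /= cabsBC => h; apply/ltW/h.
  by rewrite -addnn -addnS leq_addr.
move=> K cK Kd e e0; have [N _ NP] := wg K cK Kd e e0.
exists N => // n /= Nn z Kz; rewrite -gT; last exact: Kd.
have := NP n.*2 _ z Kz; rewrite /w odd_double doubleK; apply => /=.
by rewrite -addnn; apply: leq_trans Nn _; exact: leq_addr.
Qed.

End Holomorphic.

(** * The weighted space and its bounded functionals *)

Section WeightedSpace.
Context {R : realType}.
Local Notation C := (R[i]).
Context (v : C -> R) (E : (C -> C) -> C -> C) (c : R).
Implicit Types (f g h : C -> C) (z : C).

Definition wspace g : Prop :=
  holo g /\ vanishes_at_boundary (fun z => v z * cabs (E g z)).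
Definition wnorm g : R :=
  c * cabs (g 0) + sup [set v z * cabs (E g z) | z in disk].

Context (hv : typical_weight v) (hE : evaluation E) (c0 : 0 <= c).

Lemma weight_gt0 z : disk z -> 0 < v z.
Proof. by case: hv => _ h _ _ _ /h /andP[]. Qed.

Lemma weight_le1 z : disk z -> v z <= 1.
Proof. by case: hv => _ h _ _ _ /h /andP[]. Qed.

Lemma wcabs_ge0 z g : disk z -> 0 <= v z * cabs (E g z).
Proof. by move=> dz; rewrite mulr_ge0 ?cabs_ge0 // ltW // weight_gt0. Qed.

Lemma wspace_near g (e : R) : wspace g -> 0 < e ->
  exists2 r : R, r < 1 & forall z, r < cabs z < 1 -> v z * cabs (E g z) < e.
Proof.
move=> [_ hg] e0; have [r [r1 rP]] := hg e e0; exists r => // z zr.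
by apply: le_lt_trans (ler_norm _) _; exact: rP.
Qed.

Lemma wspaceI g : holo g -> (forall e : R, 0 < e ->
  exists2 r : R, r < 1 & forall z, r < cabs z < 1 -> v z * cabs (E g z) < e) ->
  wspace g.
Proof.
move=> hg h; split=> // e e0; have [r r1 rP] := h e e0; exists r; split => // z zr.
by rewrite ger0_norm ?rP // wcabs_ge0 //; have /andP[] := zr.
Qed.

Lemma wcabs_lin (a : C) f g z : holo f -> holo g -> disk z ->
  v z * cabs (E (fun z => a * f z + g z) z) <=
  cabs a * (v z * cabs (E f z)) + v z * cabs (E g z).
Proof.
move=> hf hg dz; rewrite (ev_lin hE) // mulrCA -mulrDr ler_pM2l ?weight_gt0 //.
by rewrite -cabsM; exact: cabsD.
Qed.

Lemma wspace_lin (a : C) f g : wspace f -> wspace g -> wspace (fun z => a * f z + g z).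
Proof.
move=> sf sg; have [hf _] := sf; have [hg _] := sg.
apply: wspaceI => [|e e0]; first exact: holo_lin.
have a0 := cabs_ge0 a; have ea : 0 < e / 2 / (cabs a + 1) by rewrite !divr_gt0 //; lra.
have [r1 r11 P1] := wspace_near sf ea; have e2 : 0 < e / 2 by lra.
have [r2 r21 P2] := wspace_near sg e2.
exists (Num.max r1 r2) => [|z]; first by rewrite gt_max r11.
rewrite gt_max => /andP[/andP[z1 z2] zd].
apply: le_lt_trans (wcabs_lin a hf hg zd) _.
have {P1}:= P1 z; rewrite z1 zd => /(_ isT); rewrite ltr_pdivlMr; last by lra.
have {P2}:= P2 z; rewrite z2 zd => /(_ isT).
by have := wcabs_ge0 f zd; nra.
Qed.

Lemma wspace_sub f g : wspace f -> wspace g -> wspace (fun z => f z - g z).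
Proof.
move=> sf sg; have -> : (fun z => f z - g z) = (fun z => -1 * g z + f z).
  by apply/funext => z; ring.
exact: wspace_lin.
Qed.

Lemma ev_sub f g z : holo f -> holo g -> disk z ->
  E (fun z => f z - g z) z = E f z - E g z.
Proof.
move=> hf hg dz; have -> : (fun z => f z - g z) = (fun z => -1 * g z + f z).
  by apply/funext => w; ring.
by rewrite (ev_lin hE) //; ring.
Qed.

Lemma ev_zero z : disk z -> E (fun=> 0) z = 0.
Proof.
move=> dz; have := ev_sub (@holo_cst R 0) (@holo_cst R 0) dz.
by rewrite !subrr.
Qed.

Lemma wspace_zero : wspace (fun=> 0).
Proof.
apply: wspaceI => [|e e0]; first exact: holo_cst.
exists 0; first by [].
by move=> z /andP[_ dz]; rewrite ev_zero // cabs0 mulr0.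
Qed.

(** This makes the supremum in [wnorm] meaningful: decay at the boundary bounds the values for |z| >
    r, local boundedness those for |z| <= r. *)
Lemma wspace_bounded g : wspace g ->
  exists2 B : R, 0 <= B & forall z, disk z -> v z * cabs (E g z) <= B.
Proof.
move=> sg; have [r r1 rP] := wspace_near sg ltr01.
have [hg _] := sg; have [B B0 BP] := ev_bounded hE hg r1.
exists (B + 1) => [|z dz]; first by lra.
have [zr|rz] := leP (cabs z) r; last by have := rP z; rewrite rz dz => /(_ isT); lra.
by have := BP z zr; have := weight_le1 dz; have := weight_gt0 dz; have := cabs_ge0 (E g z); nra.
Qed.

Lemma wcabs_le_wnorm g z : wspace g -> disk z -> v z * cabs (E g z) <= wnorm g.
Proof.
move=> sg dz; have [B B0 BP] := wspace_bounded sg.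
have : v z * cabs (E g z) <= sup [set v z * cabs (E g z) | z in disk].
  by apply: ub_le_sup; [exists B => _ [w dw <-]; exact: BP|exists z].
by rewrite /wnorm; have := mulr_ge0 c0 (cabs_ge0 (g 0)); lra.
Qed.

Lemma wnorm_le g (B : R) : (forall z, disk z -> v z * cabs (E g z) <= B) ->
  wnorm g <= c * cabs (g 0) + B.
Proof.
move=> gB; rewrite lerD2l; apply: ge_sup; last by move=> _ [z dz <-]; exact: gB.
by exists (v 0 * cabs (E g 0)), 0 => //; exact: disk0.
Qed.

Lemma wnorm_ge0 g : wspace g -> 0 <= wnorm g.
Proof. by move=> sg; apply: le_trans (wcabs_le_wnorm sg disk0); exact/wcabs_ge0/disk0. Qed.

(** Members of the space are functions on all of C, but the norm sees them only in the disc: f - g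
    has norm 0, and boundedness of L makes it invisible to L. *)
Lemma wdual_eqD L f g : Ydual wspace wnorm L -> wspace f -> wspace g -> eqD f g ->
  L f = L g.
Proof.
move=> [Llin [M LM]] sf sg fg.
have sfg := wspace_sub sf sg; have [hf _] := sf; have [hg _] := sg.
have /LM := sfg.
have -> : wnorm (fun z => f z - g z) = 0.
  apply/eqP; rewrite eq_le wnorm_ge0 // andbT.
  have := @wnorm_le (fun z => f z - g z) 0; rewrite fg ?subrr ?cabs0 ?mulr0 ?addr0; last exact: disk0.
  by apply => z dz; rewrite ev_sub // (ev_eqD hE fg) // subrr cabs0 mulr0.
rewrite mulr0 => L0; have {L0} L0 : L (fun z => f z - g z) = 0.
  by apply: cabs0_eq0; apply/eqP; rewrite eq_le L0 cabs_ge0.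
have := Llin 1 _ _ sfg sg; rewrite L0 mulr0 add0r => <-.
by congr L; apply/funext => z; ring.
Qed.

Lemma wdual_zero L : Ydual wspace wnorm L -> L (fun=> 0) = 0.
Proof.
move=> [Llin _]; have := Llin 1 _ _ wspace_zero wspace_zero.
by rewrite mulr0 addr0 mul1r => /eqP; rewrite -subr_eq0 opprD addrA subrr sub0r oppr_eq0 => /eqP.
Qed.

Lemma wdual_sub L f g : Ydual wspace wnorm L -> wspace f -> wspace g ->
  L (fun z => f z - g z) = L f - L g.
Proof.
move=> [Llin _] sf sg; have -> : (fun z => f z - g z) = (fun z => -1 * g z + f z).
  by apply/funext => w; ring.
by rewrite Llin //; ring.
Qed.

Lemma wdual_ev z : disk z -> Ydual wspace wnorm (fun g => E g z).
Proof.
move=> dz; split=> [a f g [hf _] [hg _]|]; first exact: (ev_lin hE).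
exists (v z)^-1 => f sf; rewrite -(ler_pM2l (weight_gt0 dz)) mulrA divff ?mul1r.
  exact: wcabs_le_wnorm.
by rewrite gt_eqF // weight_gt0.
Qed.

Lemma phaseP (l : C) : exists2 a : C, cabs a = 1 & a * l = ((cabs l)%:C)%C.
Proof.
have [->|l0] := eqVneq l 0; first by exists 1; rewrite ?cabs1 // mulr0 cabs0.
exists (((cabs l)%:C)%C / l); last by rewrite divfK.
by rewrite cabsM cabsV cabsR ger0_norm ?cabs_ge0 // divff // gt_eqF // cabs_gt0.
Qed.

(* Gliding hump: were L not small along h, one could add up k unimodular
   multiples of members of h whose bulks lie in essentially disjoint annuli, so
   that the sum has norm bounded independently of k but L-value at least k e. *)
Lemma wdual_uc_null L (h : nat -> C -> C) (M : R) : Ydual wspace wnorm L ->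
  (forall n, wspace (h n)) ->
  (forall n z, disk z -> v z * cabs (E (h n) z) <= M) ->
  uc_cvg h (fun=> 0) ->
  forall e : R, 0 < e -> exists N, forall n, (N <= n)%N -> cabs (L (h n)) < e.
Proof.
move=> dL sh hM h0 e e0; apply: contrapT => H.
have {H} big N : exists2 n, (N <= n)%N & e <= cabs (L (h n)).
  apply: contrapT => H'; apply: H; exists N => n Nn; rewrite ltNge; apply/negP => h'.
  by apply: H'; exists n.
have hol n : holo (h n) by have [] := sh n.
have M0 : 0 <= M by apply: le_trans (hM 0%N _ disk0); exact/wcabs_ge0/disk0.
have [Llin [ML LM]] := dL.
(* Here [d] is the overlap error allowed per summand; it is later set to 1/k, which keeps the total
   error at 1. The value at 0 is tracked separately because [wnorm] contains it. *)
have build (d : R) (k : nat) : 0 < d -> exists H, [/\ wspace H,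
    (forall z, disk z -> v z * cabs (E H z) <= M + k%:R * d),
    cabs (H 0) <= k%:R * d & k%:R * e <= complex.Re (L H)].
  move=> d0; elim: k => [|k [H [sH HM H00 LH]]].
    exists (fun=> 0); split; rewrite ?mul0r ?cabs0 // ?wdual_zero //.
      exact: wspace_zero.
    by move=> z dz; rewrite ev_zero // cabs0 mulr0 addr0.
  have [r r1 rP] := wspace_near sH d0.
  have [N1 N1P] := ev_uc hE hol h0 r1 d0.
  have [N2 N2P] := uc_cvg_point h0 disk0 d0.
  have [n nN en] := big (maxn N1 N2); move: nN; rewrite geq_max => /andP[n1 n2].
  have [a a1 aL] := phaseP (L (h n)); have [hH _] := sH.
  exists (fun z => a * h n z + H z); split.
  - exact: wspace_lin.
  - move=> z dz; apply: le_trans (wcabs_lin a (hol n) hH dz) _.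
    rewrite a1 mul1r -natr1 mulrDl mul1r.
    have kd : 0 <= k%:R * d by rewrite mulr_ge0 // ltW.
    (* Up to radius r the new summand is below [d] by the choice of n; beyond r the old sum is, by
       the choice of r. *)
    have [zr|rz] := leP (cabs z) r.
      have := N1P n n1 z zr; have := HM z dz; have := weight_le1 dz.
      have := weight_gt0 dz; have := cabs_ge0 (E (h n) z); nra.
    by have := rP z; rewrite rz dz => /(_ isT); have := hM n z dz; lra.
  - apply: le_trans (cabsD _ _) _; rewrite cabsM a1 mul1r -natr1 mulrDl mul1r.
    by have := N2P n n2; rewrite subr0; lra.
  - by rewrite Llin // aL ReD /= -natr1 mulrDl mul1r; lra.
pose K := `|ML| * (c + M + 1).
have K0 : 0 <= K / e by apply: divr_ge0; [apply: mulr_ge0; [exact: normr_ge0|have := c0; lra]|exact: ltW].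
pose k := (Num.bound (K / e)).+1.
have k0 : 0 < (k%:R : R) by rewrite ltr0n.
have ki0 : 0 < (k%:R : R)^-1 by rewrite invr_gt0.
have [H [sH HM H00 LH]] := build _ k ki0.
have kk : (k%:R : R) * k%:R^-1 = 1 by rewrite divff // gt_eqF.
move: HM H00; rewrite kk => HM H00.
have nH : wnorm H <= c + M + 1.
  by apply: le_trans (wnorm_le HM) _; have := ler_pM c0 (cabs_ge0 (H 0)) (lexx c) H00; lra.
have LK : cabs (L H) <= K.
  apply: le_trans (LM _ sH) _; apply: le_trans (ler_norm _) _.
  by rewrite normrM ler_wpM2l // ger0_norm // wnorm_ge0.
have : (k%:R : R) * e <= K.
  by apply: le_trans LH _; apply: le_trans (ler_norm _) _; apply: le_trans (cabs_geRe _) LK.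
rewrite -ler_pdivlMr // => h'; have := archi_boundP K0.
have : ((Num.bound (K / e))%:R : R) < k%:R by rewrite ltr_nat.
by lra.
Qed.

End WeightedSpace.

(** * Norm compactness and decay of the adjoint functionals *)

Section CompactOperators.
Context {R : realType}.
Local Notation C := (R[i]).
Context (v : C -> R) (E : (C -> C) -> C -> C) (c : R).
Context (T : (C -> C) -> C -> C) (V : completeNormedModType C) (j : V -> C -> C).
Context (hv : typical_weight v) (hE : evaluation E) (c0 : 0 <= c).
Context (hT : intrinsic T) (hj : initial_space j).
Local Notation Y := (wspace v E).
Local Notation nY := (wnorm v E c).
Context (hb : bounded_op j Y nY T).
Implicit Types (x y : V) (z : C).

Lemma init_holo x : holo (j x).
Proof. by case: hj. Qed.
Arguments init_holo : clear implicits.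

Lemma op_wspace x : Y (T (j x)).
Proof. by case: hb. Qed.

Lemma op_holo x : holo (T (j x)).
Proof. by case: (op_wspace x). Qed.
Arguments op_holo : clear implicits.

Lemma op_lin (a : C) x y :
  eqD (T (j (a *: x + y))) (fun z => a * T (j x) z + T (j y) z).
Proof.
move=> z dz; case: hT => _ Teq Tlin _; case: hj => _ jlin _ _ _.
rewrite -(Tlin a _ _ (init_holo x) (init_holo y) z dz).
by apply: Teq (jlin a x y) z dz => //; [exact: init_holo|apply: holo_lin; exact: init_holo].
Qed.

Lemma op_bounded : exists2 M : R, 0 <= M & forall x, `|x| <= 1 ->
  nY (T (j x)) <= M /\ forall z, disk z -> v z * cabs (E (T (j x)) z) <= M.
Proof.
case: hb => _ [M MP]; exists `|M| => // x x1.
have h : nY (T (j x)) <= `|M| := le_trans (MP x x1) (ler_norm M).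
by split=> // z dz; apply: le_trans h; apply: wcabs_le_wnorm => //; exact: op_wspace.
Qed.

Local Notation ev z := (fun g : C -> C => E g z).

Lemma has_sup_dnorm z : disk z ->
  has_sup [set cabs (adjoint j T (ev z) x) | x in [set x : V | `|x| <= 1]].
Proof.
move=> dz; have [M M0 MP] := op_bounded; split.
  by exists (cabs (adjoint j T (ev z) 0)), 0 => //=; rewrite normr0.
exists (M / v z) => _ [x /= x1 <-]; rewrite ler_pdivlMr ?(weight_gt0 hv) // mulrC.
exact: (MP x x1).2.
Qed.

Lemma dnorm_ge z x : disk z -> `|x| <= 1 ->
  cabs (E (T (j x)) z) <= dnorm (adjoint j T (ev z)).
Proof.
move=> dz x1; apply: ub_le_sup; last by exists x.
by have [_] := has_sup_dnorm dz.
Qed.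

Lemma dnorm_ge0 z : disk z -> 0 <= dnorm (adjoint j T (ev z)).
Proof.
by move=> dz; apply: le_trans (cabs_ge0 _) (@dnorm_ge z 0 dz _); rewrite normr0.
Qed.

Lemma compact_of_dnorm_vanishes :
  vanishes_at_boundary (fun z => v z * dnorm (adjoint j T (ev z))) ->
  compact_op j Y nY T.
Proof.
move=> hvan u u1; case: hj => _ _ _ _ /(_ u u1)[phi [x [phiP jx]]].
exists phi, (T (j x)); split => //; first exact: op_wspace.
have Tu := intrinsic_cvg hT (fun n => init_holo (u (phi n))) (init_holo x) jx.
have h0 := uc_cvg_sub Tu.
have hh n : holo (fun z => T (j (u (phi n))) z - T (j x) z).
  by apply: holo_sub; exact: op_holo.
have sh n : Y (fun z => T (j (u (phi n))) z - T (j x) z).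
  by apply: wspace_sub => //; exact: op_wspace.
apply/cvgr0Pnorm_lt => e e0.
have e3 : 0 < e / 4 by lra.
have [r1 [r11 r1P]] := hvan _ e3.
have [r2 r21 r2P] := wspace_near (op_wspace x) e3.
have r3 : Num.max r1 r2 < 1 by rewrite gt_max r11.
have [N1 N1P] := ev_uc hE hh h0 r3 e3.
(* The denominator is c + 1 because c = 0 is allowed. *)
have c1 : 0 < e / 4 / (c + 1) by rewrite divr_gt0 //; have := c0; lra.
have [N2 N2P] := uc_cvg_point h0 disk0 c1.
exists (maxn N1 N2) => // n /=; rewrite geq_max => /andP[n1 n2].
rewrite ger0_norm; last exact: wnorm_ge0.
have bnd z : disk z -> v z * cabs (E (fun z => T (j (u (phi n))) z - T (j x) z) z) <= e / 2.
  move=> dz; have v0 := weight_gt0 hv dz; have v1 := weight_le1 hv dz.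
  have [zr|rz] := leP (cabs z) (Num.max r1 r2).
    have := N1P n n1 z zr; set q := cabs _; have : 0 <= q by exact: cabs_ge0.
    by nra.
  move: rz; rewrite gt_max => /andP[z1 z2]; rewrite ev_sub //; try exact: op_holo.
  have := r1P z; rewrite z1 dz => /(_ isT) h1.
  have {h1} := le_lt_trans (ler_norm _) h1.
  have := r2P z; rewrite z2 dz => /(_ isT).
  have := @dnorm_ge z (u (phi n)) dz (u1 _).
  have := cabsB (E (T (j (u (phi n)))) z) (E (T (j x)) z).
  by set q1 := cabs _; set q2 := cabs _; set q3 := cabs _; set d := dnorm _; nra.
apply: le_lt_trans (wnorm_le c bnd) _.
have := N2P n n2; rewrite subr0; set q := cabs _; have : 0 <= q by exact: cabs_ge0.
rewrite ltr_pdivlMr; last by have := c0; lra.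
by have := c0; nra.
Qed.

Lemma dnorm_vanishes_of_compact : compact_op j Y nY T ->
  vanishes_at_boundary (fun z => v z * dnorm (adjoint j T (ev z))).
Proof.
move=> hc e e0; apply: contrapT => H.
(* The norm of the adjoint functional is a supremum that need not be attained; half of [e] is given
   up to get an actual vector. *)
have bad (n : nat) : exists zx : C * V, [/\ 1 - n.+1%:R^-1 < cabs zx.1 < 1,
    `|zx.2| <= 1 & e / 2 < v zx.1 * cabs (E (T (j zx.2)) zx.1)].
  apply: contrapT => H'; apply: H; exists (1 - n.+1%:R^-1); split.
    by rewrite ltrBlDr ltrDl invr_gt0 ltr0n.
  move=> z zr; have dz : disk z by have /andP[] := zr.
  have v0 := weight_gt0 hv dz.
  rewrite ger0_norm ?mulr_ge0 ?dnorm_ge0 ?(ltW v0) // ltNge; apply/negP => he.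
  have : e / 2 / v z < dnorm (adjoint j T (ev z)) by rewrite ltr_pdivrMr // mulrC; lra.
  move=> /sup_gt [|_ [x x1 <-] hx]; first by have [] := has_sup_dnorm dz.
  apply: H'; exists (z, x); split => //=.
  by move: hx; rewrite /adjoint ltr_pdivrMr // [_ * v z]mulrC.
have [zx zxP] := choice bad.
have [n|phi [g [phiP Yg]]] := hc (fun n => (zx n).2); first by have [] := zxP n.
move/cvgr0Pnorm_lt; have e4 : 0 < e / 4 by lra.
move=> /(_ _ e4)[N1 _ N1P]; have [r r1 rP] := wspace_near Yg e4.
(* From this index on 1/(n + 1) <= 1 - r, so the chosen points lie beyond radius r, where g
   contributes less than e/4; with norm distance below e/4 this contradicts the lower bound e/2. *)
pose N2 := Num.bound (1 - r)^-1.
have r0 : 0 < 1 - r by lra.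
pose n := maxn N1 N2; have nphi := homo_ltn_ge phiP n.
have [zb x1 big] := zxP (phi n); have /andP[zl dz] := zb.
have zr : r < cabs (zx (phi n)).1.
  apply: le_lt_trans zl; rewrite lerBrDr -lerBrDl -[leRHS]invrK lef_pV2 ?posrE ?invr_gt0 //.
  apply: ltW; apply: lt_le_trans (archi_boundP _) _; first by rewrite invr_ge0 ltW.
  by rewrite ler_nat ltnW // ltnS (leq_trans _ nphi) // leq_maxr.
have Yd : Y (fun z => T (j (zx (phi n)).2) z - g z) by apply: wspace_sub => //; exact: op_wspace.
have := N1P n (leq_maxl _ _); rewrite ger0_norm; last exact: wnorm_ge0.
have := wcabs_le_wnorm hv hE c0 Yd dz; rewrite ev_sub //; first last.
- by case: Yg.
- exact: op_holo.
have := rP _ _; move=> /(_ (zx (phi n)).1); rewrite zr dz => /(_ isT).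
have := cabsD (E (T (j (zx (phi n)).2)) (zx (phi n)).1 - E g (zx (phi n)).1) (E g (zx (phi n)).1).
rewrite subrK; move: big; have := weight_gt0 hv dz.
set q1 := cabs _; set q2 := cabs _; set q3 := cabs _; set w := wnorm _ _ _ _.
by nra.
Qed.

End CompactOperators.

(** * Cluster points of filters on the unit ball of an initial space *)

Section WeakCluster.
Context {R : realType}.
Local Notation C := (R[i]).

Definition ratpoint (n : nat) : C :=
  if @unpickle (rat * rat)%type n is Some p then (ratr p.1 +i* ratr p.2)%C else 0.

Lemma ratpoint_dense (z : C) (d : R) : 0 < d -> exists n, cabs (ratpoint n - z) < d.
Proof.
move=> d0; have dd (t : R) : t - d / 2 < t + d / 2 by lra.
have [p] := rat_in_itvoo (dd (complex.Re z)); rewrite in_itv /= => pP.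
have [q] := rat_in_itvoo (dd (complex.Im z)); rewrite in_itv /= => qP.
exists (pickle (p, q)); rewrite /ratpoint pickleK /=.
apply: le_lt_trans (cabs_leReIm _) _; rewrite ReB ImB /=.
have h1 : `|ratr p - complex.Re z| < d / 2 by rewrite ltr_norml; lra.
have h2 : `|ratr q - complex.Im z| < d / 2 by rewrite ltr_norml; lra.
by lra.
Qed.

Lemma eqD_ratpoint (f g : C -> C) : holo f -> holo g ->
  (forall n, disk (ratpoint n) -> f (ratpoint n) = g (ratpoint n)) -> eqD f g.
Proof.
move=> hf hg fg z dz; apply/eqP; rewrite -subr_eq0; apply/eqP; apply: cabs0_eq0.
apply/eqP; rewrite eq_le cabs_ge0 andbT; apply/ler_addgt0Pl => e e0; rewrite addr0.
have e2 : 0 < e / 2 by lra.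
have /cont_cabsP /(_ _ e2) [d1 d10 P1] := holo_cont hf dz.
have /cont_cabsP /(_ _ e2) [d2 d20 P2] := holo_cont hg dz.
have /nbhs_cabsP [d3 d30 P3] := nbhs_disk dz.
have [n] : exists n, cabs (ratpoint n - z) < Num.min d1 (Num.min d2 d3).
  by apply: ratpoint_dense; rewrite !lt_min d10 d20.
rewrite !lt_min => /and3P[/P1 h1 /P2 h2 /P3 /fg h3].
have := cabsB (g (ratpoint n) - g z) (f (ratpoint n) - f z).
have -> : g (ratpoint n) - g z - (f (ratpoint n) - f z) = f z - g z by rewrite h3; ring.
by lra.
Qed.

(** Compactness of the disc of radius B gives a cluster point, and for an ultrafilter a cluster
    point is a limit. *)
Lemma ultra_limit (X : Type) (U : set_system X) (f : X -> C) (B : R) :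
  UltraFilter U -> U [set x | cabs (f x) <= B] ->
  exists l : C, forall e : R, 0 < e -> U [set x | cabs (f x - l) < e].
Proof.
move=> UU UB; have PU : ProperFilter U by exact: ultra_proper.
have [l [_ lP]] := @compact_cdisk R B ((f : X -> C^o) @ U) _ UB.
exists l => e e0.
have [//|UC] := in_ultra_setVsetC [set x | cabs (f x - l) < e] UU.
have nl : nbhs (l : C^o) [set w : C^o | cabs (w - l) < e] by apply/nbhs_cabsP; exists e.
have [|w [/= h1 h2]] := lP (~` [set w : C^o | cabs (w - l) < e]) _ _ nl; first exact: UC.
by [].
Qed.

Context (V : completeNormedModType C) (j : V -> C -> C) (hj : initial_space j).

(** Otherwise the unit ball contains a sequence whose n-th value at z exceeds n in modulus, and no
    subsequence of it converges at z. *)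
Lemma init_bounded z : disk z ->
  exists B : R, forall x : V, `|x| <= 1 -> cabs (j x z) <= B.
Proof.
move=> dz; apply: contrapT => H.
have bad (n : nat) : exists x : V, `|x| <= 1 /\ n%:R < cabs (j x z).
  apply: contrapT => H'; apply: H; exists n%:R => x x1; rewrite leNgt; apply/negP => h.
  by apply: H'; exists x.
have [u uP] := choice bad; case: hj => _ _ _ _ /(_ u (fun n => (uP n).1)) [phi [x [phiP jx]]].
have [N NP] := uc_cvg_point jx dz ltr01.
pose K := cabs (j x z) + 1; have K0 : 0 <= K by rewrite addr_ge0 ?cabs_ge0.
pose n := maxn N (Num.bound K); have := NP n (leq_maxl _ _); have [_] := uP (phi n).
have := cabsD (j (u (phi n)) z - j x z) (j x z); rewrite subrK.
have := archi_boundP K0; have : ((Num.bound K)%:R : R) <= (phi n)%:R.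
  by rewrite ler_nat (leq_trans (leq_maxr N _)) // homo_ltn_ge.
by rewrite /K; lra.
Qed.

(* Relative sequential compactness of the unit ball becomes compactness for
   filters: along an ultrafilter finer than F the values at the countably many
   rational points converge, and these values determine the cluster point. *)
Lemma init_ball_cluster (F : set_system V) : ProperFilter F -> F [set x | `|x| <= 1] ->
  exists x0 : V, forall A, F A -> exists u : nat -> V,
    (forall n, A (u n) /\ `|u n| <= 1) /\ uc_cvg (fun n => j (u n)) (j x0).
Proof.
move=> PF FB; have [U [UU FU]] := ultraFilterLemma PF.
have PU : ProperFilter U by exact: ultra_proper.
have UB : U [set x | `|x| <= 1] by exact: FU.
have hol x : holo (j x) by case: hj.
have lims i : exists l : C, disk (ratpoint i) ->
    forall e : R, 0 < e -> U [set x | cabs (j x (ratpoint i) - l) < e].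
  have [di|ndi] := pselect (disk (ratpoint i)); last by exists 0.
  have [B BP] := init_bounded di.
  have [|l lP] := @ultra_limit V U (fun x => j x (ratpoint i)) B UU; last by exists l.
  exact: filterS BP UB.
have [l lP] := choice lims.
have pick A : U A -> exists (u : nat -> V) (x : V), [/\ (forall n, A (u n) /\ `|u n| <= 1),
    uc_cvg (fun n => j (u n)) (j x) &
    forall i, disk (ratpoint i) -> j x (ratpoint i) = l i].
  move=> UA.
  have fin (e : R) (m : nat) : 0 < e -> U [set x | forall i, (i < m)%N -> disk (ratpoint i) ->
      cabs (j x (ratpoint i) - l i) < e].
    move=> e0; elim: m => [|m IH]; first by apply: filterS filterT => x _ i.
    have Um : U [set x | disk (ratpoint m) -> cabs (j x (ratpoint m) - l m) < e].
      have [dm|ndm] := pselect (disk (ratpoint m)).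
        by apply: filterS (lP m dm e e0) => x + _.
      by apply: filterS filterT => x _ /ndm.
    apply: filterS (filterI IH Um) => x [h1 h2] i; rewrite ltnS leq_eqVlt.
    by case/orP => [/eqP ->|]; [exact: h2|exact: h1].
  (* A filter meets only finitely many conditions at once, so the n-th vector is asked to
     approximate the limits at the first n rational points only. *)
  have ex n : exists x : V, [/\ A x, `|x| <= 1 & forall i, (i < n)%N -> disk (ratpoint i) ->
      cabs (j x (ratpoint i) - l i) < n.+1%:R^-1].
    have n0 : 0 < (n.+1%:R : R)^-1 by rewrite invr_gt0 ltr0n.
    have UAB : U (A `&` [set x | `|x| <= 1]) by exact: filterI.
    have [x [[Ax xB] xP]] := filter_ex (filterI UAB (fin _ n n0)).
    by exists x.
  have [w wP] := choice ex.
  have w1 n : `|w n| <= 1 by have [] := wP n.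
  case: hj => _ _ _ _ /(_ w w1) [phi [x [phiP jx]]].
  exists (fun n => w (phi n)), x; split => // [n|i di]; first by have [] := wP (phi n).
  apply/eqP; rewrite -subr_eq0; apply/eqP; apply: cabs0_eq0.
  apply/eqP; rewrite eq_le cabs_ge0 andbT; apply/ler_addgt0Pl => e e0; rewrite addr0.
  have e2 : 0 < e / 2 by lra.
  have [N NP] := uc_cvg_point jx di e2.
  have e20 : 0 <= (e / 2)^-1 by rewrite invr_ge0 ltW.
  pose n := maxn N (maxn i.+1 (Num.bound (e / 2)^-1)).
  have nphi := homo_ltn_ge phiP n.
  have [_ _ /(_ i _ di)] := wP (phi n).
  have -> : (i < phi n)%N.
    by apply: leq_trans nphi; rewrite /n !leq_max leqnn orbT.
  move=> /(_ isT) h.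
  have h2 : ((phi n).+1%:R : R)^-1 <= e / 2.
    rewrite -[leRHS]invrK lef_pV2 ?posrE ?invr_gt0 ?ltr0n //.
    apply: ltW; apply: lt_le_trans (archi_boundP e20) _; rewrite ler_nat ltnW // ltnS.
    by apply: leq_trans nphi; rewrite /n !leq_max leqnn !orbT.
  have {h h2} := lt_le_trans h h2; have := NP n (leq_maxl _ _).
  have := cabsB (j (w (phi n)) (ratpoint i) - l i) (j (w (phi n)) (ratpoint i) - j x (ratpoint i)).
  have -> : j (w (phi n)) (ratpoint i) - l i - (j (w (phi n)) (ratpoint i) - j x (ratpoint i))
    = j x (ratpoint i) - l i by ring.
  by lra.
(* The limit found for the whole space serves as [x0]: its values at the rational points are [l], as
   are those of the limit found for any other A. *)
have [_ [x0 [_ _ x0P]]] := pick setT filterT.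
exists x0 => A /FU /pick [u [x [uA ux xP]]]; exists u; split => //.
suff -> : x0 = x by [].
case: hj => _ _ jinj _ _; apply: jinj; apply: eqD_ratpoint => // n dn.
by rewrite x0P // xP.
Qed.

End WeakCluster.

(** * Weak cluster points of the image of the unit ball *)

Section WeaklyCompact.
Context {R : realType}.
Local Notation C := (R[i]).
Context (v : C -> R) (E : (C -> C) -> C -> C) (c : R).
Context (T : (C -> C) -> C -> C) (V : completeNormedModType C) (j : V -> C -> C).
Context (hv : typical_weight v) (hE : evaluation E) (c0 : 0 <= c).
Context (hT : intrinsic T) (hj : initial_space j).
Local Notation Y := (wspace v E).
Local Notation nY := (wnorm v E c).
Context (hb : bounded_op j Y nY T).

Lemma wcompact_of_bounded : wcompact_op j Y nY T.
Proof.
move=> F PF FB; have [x0 x0P] := init_ball_cluster hj PF FB.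
have sT x : Y (T (j x)) by exact: (op_wspace hb).
exists (T (j x0)); split => // k Ls e dLs e0 A FA.
(* The sequence depends on A, its limit [x0] does not; one far enough term then serves all k
   functionals. *)
have [u [uA ux]] := x0P A FA.
have hol x : holo (j x) by case: hj.
have Tu := intrinsic_cvg hT (fun n => hol (u n)) (hol x0) ux.
have sh n : Y (fun z => T (j (u n)) z - T (j x0) z) by exact: wspace_sub.
have [M M0 MP] := op_bounded hv hE c0 hb.
have [B B0 BP] := wspace_bounded hv hE (sT x0).
have hM n z : disk z -> v z * cabs (E (fun z => T (j (u n)) z - T (j x0) z) z) <= M + B.
  move=> dz; rewrite ev_sub //; try by have [] := sT x0; try by have [] := sT (u n).
  have [_ /(_ z dz)] := MP (u n) (uA n).2; have := BP z dz.
  have := cabsB (E (T (j (u n))) z) (E (T (j x0)) z); have := weight_gt0 hv dz.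
  by set q1 := cabs _; set q2 := cabs _; set q3 := cabs _; nra.
have [N NP] : exists N, forall i, (i < k)%N -> forall n, (N <= n)%N ->
    cabs (Ls i (fun z => T (j (u n)) z - T (j x0) z)) < e.
  elim: k dLs => [|k IH] dLs; first by exists 0%N.
  have [i ik|N1 N1P] := IH; first by apply: dLs; exact: ltnW.
  have [N2 N2P] := wdual_uc_null hv hE c0 (dLs k (ltnSn k)) sh hM (uc_cvg_sub Tu) e0.
  exists (maxn N1 N2) => i; rewrite ltnS leq_eqVlt => ik n; rewrite geq_max => /andP[n1 n2].
  by case/orP: ik => [/eqP ->|ik]; [exact: N2P|exact: N1P].
exists (u N); split; first exact: (uA N).1.
move=> i ik; rewrite -(wdual_sub (dLs i ik)) //; exact: NP.
Qed.

End WeaklyCompact.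

(** * Dual and bidual of a Banach space, and Helly's lemma *)

Section Helly.
Context {R : realType}.
Local Notation C := (R[i]).
Context (V : completeNormedModType C).
Implicit Types (phi psi : V -> C) (x y : V).

Lemma Re_norm_le1 x : (`|x| <= 1) = (complex.Re `|x| <= 1).
Proof.
have : 0 <= `|x| by [].
by case: `|x| => p q; rewrite !lecE /= => /andP[/eqP -> _]; rewrite eqxx.
Qed.

Lemma normV_real x : `|x| = ((complex.Re `|x|)%:C)%C.
Proof.
have : 0 <= `|x| by [].
by case: `|x| => p q; rewrite !lecE /= => /andP[/eqP -> _].
Qed.

Lemma linear0_of phi : (forall (a : C) x y, phi (a *: x + y) = a * phi x + phi y) ->
  phi 0 = 0.
Proof.
move=> l; have := l 1 0 0; rewrite scaler0 addr0 mul1r.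
by move=> /eqP; rewrite -subr_eq0 opprD addrA subrr sub0r oppr_eq0 => /eqP.
Qed.

Lemma Xdual_of_ball phi (K : R) :
  (forall (a : C) x y, phi (a *: x + y) = a * phi x + phi y) ->
  (forall x, `|x| <= 1 -> cabs (phi x) <= K) -> Xdual phi.
Proof.
move=> l hK; split=> //; exists K => x; have p0 := linear0_of l.
have [->|x0] := eqVneq x 0; first by rewrite p0 cabs0 normr0 mulr0.
have nx : `|x| != 0 by rewrite normr_eq0.
have -> : phi x = `|x| * phi (`|x|^-1 *: x).
  have := l `|x| (`|x|^-1 *: x) 0.
  by rewrite !addr0 p0 addr0 scalerA divff // scale1r.
rewrite cabsM mulrC ler_pM ?cabs_ge0 //.
  by apply: hK; rewrite normrZ normfV normr_id mulVf.
by rewrite [in leLHS]normV_real cabsR ger0_norm // -ler0c -normV_real.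
Qed.

Lemma Xdual_ball phi : Xdual phi ->
  exists2 K : R, 0 <= K & forall x, `|x| <= 1 -> cabs (phi x) <= K.
Proof.
move=> [_ [M MP]]; exists `|M| => // x; rewrite Re_norm_le1 => x1.
have x0 : 0 <= complex.Re `|x| by rewrite -ler0c -normV_real.
by apply: le_trans (MP x) _; have := ler_norm M; have := normr_ge0 M; nra.
Qed.

Lemma Xdual_lin (a : C) phi psi : Xdual phi -> Xdual psi ->
  Xdual (fun x => a * phi x + psi x).
Proof.
move=> d1 d2; have [K1 K10 K1P] := Xdual_ball d1; have [K2 K20 K2P] := Xdual_ball d2.
apply: (@Xdual_of_ball _ (cabs a * K1 + K2)) => [b x y|x x1].
  by case: d1 => -> _; case: d2 => -> _; ring.
apply: le_trans (cabsD _ _) _; rewrite cabsM lerD ?K2P //.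
by rewrite ler_wpM2l ?cabs_ge0 ?K1P.
Qed.

Lemma Xdual_zero : Xdual (fun _ : V => 0 : C).
Proof.
by apply: (@Xdual_of_ball _ 0) => [a x y|x _]; rewrite ?cabs0 // mulr0 addr0.
Qed.

Lemma dnorm_ub phi x : Xdual phi -> `|x| <= 1 -> cabs (phi x) <= dnorm phi.
Proof.
move=> d x1; have [K K0 KP] := Xdual_ball d.
by apply: ub_le_sup; [exists K => _ [y y1 <-]; exact: KP|exists x].
Qed.

Lemma dnorm_le phi (K : R) : (forall x, `|x| <= 1 -> cabs (phi x) <= K) -> dnorm phi <= K.
Proof.
move=> h; apply: ge_sup; last by move=> _ [x x1 <-]; exact: h.
by exists (cabs (phi 0)), 0 => //=; rewrite normr0.
Qed.

Lemma Xdual_sum (a : nat -> C) (phi : nat -> V -> C) (k : nat) :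
  (forall i, (i < k)%N -> Xdual (phi i)) -> Xdual (fun x => \sum_(i < k) a i * phi i x).
Proof.
elim: k => [|k IH] d.
  have -> : (fun x : V => \sum_(i < 0) a i * phi i x) = (fun=> 0).
    by apply/funext => x; rewrite big_ord0.
  exact: Xdual_zero.
have -> : (fun x : V => \sum_(i < k.+1) a i * phi i x) =
    (fun x => a k * phi k x + \sum_(i < k) a i * phi i x).
  by apply/funext => x; rewrite big_ord_recr addrC.
by apply: Xdual_lin; [exact: d|apply: IH => i ik; apply: d; exact: ltnW].
Qed.

Lemma Xbidual_zero Psi : Xbidual Psi -> Psi (fun _ : V => 0 : C) = 0.
Proof.
move=> [l _]; have := l 1 _ _ Xdual_zero Xdual_zero.
rewrite mulr0 addr0 mul1r.
by move=> /eqP; rewrite -subr_eq0 opprD addrA subrr sub0r oppr_eq0 => /eqP.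
Qed.

Lemma Xbidual_sum Psi (a : nat -> C) (phi : nat -> V -> C) (k : nat) : Xbidual Psi ->
  (forall i, (i < k)%N -> Xdual (phi i)) ->
  Psi (fun x => \sum_(i < k) a i * phi i x) = \sum_(i < k) a i * Psi (phi i).
Proof.
move=> bP; elim: k => [|k IH] d.
  have -> : (fun x : V => \sum_(i < 0) a i * phi i x) = (fun=> 0).
    by apply/funext => x; rewrite big_ord0.
  by rewrite big_ord0 Xbidual_zero.
have -> : (fun x : V => \sum_(i < k.+1) a i * phi i x) =
    (fun x => a k * phi k x + \sum_(i < k) a i * phi i x).
  by apply/funext => x; rewrite big_ord_recr addrC.
have dk i : (i < k)%N -> Xdual (phi i) by move=> ik; apply: d; exact: ltnW.
have [l _] := bP; rewrite l; [|exact: d|exact: Xdual_sum].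
by rewrite IH // big_ord_recr addrC.
Qed.

(** The convex combination (1 - t)x + ty is written in the shape [a *: u + w] in which linearity of
    functionals is stated. *)
Lemma ball_convex x y (t : R) : 0 <= t <= 1 -> `|x| <= 1 -> `|y| <= 1 ->
  `|(t%:C)%C *: (-1 *: x + y) + x| <= 1.
Proof.
move=> /andP[t0 t1] x1 y1.
have -> : (t%:C)%C *: (-1 *: x + y) + x = ((1 - t)%:C)%C *: x + (t%:C)%C *: y.
  rewrite scalerDr scalerA mulrN1 rmorphB /= scalerBl scale1r scaleNr.
  by rewrite addrAC [- _ + x]addrC.
apply: le_trans (ler_normD _ _) _; rewrite !normrZ !normcE_cabs !cabsR !ger0_norm ?subr_ge0 //.
have -> : 1 = ((1 - t)%:C)%C * 1 + (t%:C)%C * 1 :> C by rewrite !mulr1 -rmorphD /= subrK.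
by apply: lerD; apply: ler_wpM2l; rewrite ?ler0c ?subr_ge0.
Qed.

Lemma sqr_cabs (z : C) : cabs z ^+ 2 = complex.Re z ^+ 2 + complex.Im z ^+ 2.
Proof. by rewrite cabsE sqr_sqrtr // addr_ge0 ?sqr_ge0. Qed.

Lemma sqr_cabs_sub (a b : C) (t : R) :
  cabs (a - (t%:C)%C * b) ^+ 2 =
  cabs a ^+ 2 - 2 * t * complex.Re (a^*%C * b) + t ^+ 2 * cabs b ^+ 2.
Proof. by rewrite !sqr_cabs; case: a => a1 a2; case: b => b1 b2 /=; ring. Qed.

Lemma Re_sum (k : nat) (F : 'I_k -> C) :
  complex.Re (\sum_i F i) = \sum_i complex.Re (F i).
Proof. by apply: (big_morph (@complex.Re R)) => // x y; rewrite ReD. Qed.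

(* Helly: a near-minimiser x of the distance from (phi i x)_i to (Psi (phi i))_i
   over the unit ball makes a = (Psi (phi i) - phi i x)_i an almost separating
   functional, and |a|^2 is then bounded by the defect of minimality. *)
Lemma helly Psi (k : nat) (phi : nat -> V -> C) (e : R) : Xbidual Psi ->
  (forall f, Xdual f -> cabs (Psi f) <= dnorm f) ->
  (forall i, (i < k)%N -> Xdual (phi i)) -> 0 < e ->
  exists x, `|x| <= 1 /\ forall i, (i < k)%N -> cabs (phi i x - Psi (phi i)) < e.
Proof.
move=> bP P1 dphi e0; apply: contrapT => H.
pose D x := \sum_(i < k) cabs (Psi (phi i) - phi i x) ^+ 2.
have De x : `|x| <= 1 -> e ^+ 2 <= D x.
  move=> x1; rewrite leNgt; apply/negP => h; apply: H; exists x; split => // i ik.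
  rewrite cabsBC -(ltr_pXn2r (n := 2)) ?nnegrE ?cabs_ge0 ?(ltW e0) //.
  apply: le_lt_trans h; rewrite /D (bigD1 (Ordinal ik)) //= lerDl.
  by apply: sumr_ge0 => l _; exact: sqr_ge0.
have hK (i : 'I_k) : exists K : R, 0 <= K /\ forall x, `|x| <= 1 -> cabs (phi i x) <= K.
  by have [K K0 KP] := Xdual_ball (dphi i (ltn_ord i)); exists K.
have [K KP] := choice hK.
pose Kt := \sum_(i < k) (2 * K i) ^+ 2.
have Kt0 : 0 <= Kt by apply: sumr_ge0 => i _; exact: sqr_ge0.
(* The step size is chosen so that the final defect t (1 + Kt)/2 is at most e^2/2, below the lower
   bound e^2 of [D]. *)
pose t := Num.min 1 (e ^+ 2 / (1 + Kt)).
have e20 : 0 < e ^+ 2 by rewrite exprn_gt0.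
have t0 : 0 < t by rewrite lt_min ltr01 divr_gt0 //; lra.
have t1 : t <= 1 by rewrite ge_min lexx.
have tK : t * (1 + Kt) <= e ^+ 2 by rewrite -ler_pdivlMr ?ge_min ?lexx ?orbT //; lra.
pose S := [set D x | x in [set x : V | `|x| <= 1]].
have Slb : lbound S (e ^+ 2) by move=> _ [x x1 <-]; exact: De.
have Sinf : has_inf S.
  by split; [exists (D 0), 0 => //=; rewrite normr0|exists (e ^+ 2)].
have t20 : 0 < t ^+ 2 by rewrite exprn_gt0.
(* The tolerance t^2 has the order of the second-order term in t, so it survives the division by 2t
   below. *)
have [_ [x /= x1 <-] xS] := inf_adherent t20 Sinf.
have Smin y : `|y| <= 1 -> D x <= D y + t ^+ 2.
  move=> y1; have : inf S <= D y by apply: inf_lbound; [exists (e ^+ 2)|exists y].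
  by lra.
pose a i := Psi (phi i) - phi i x.
pose f y := \sum_(i < k) (a i)^*%C * phi i y.
have df : Xdual f by exact: (@Xdual_sum (fun i => (a i)^*%C)).
(* Near-minimality of x is tested by moving a fraction t towards y; the first-order change of [D] is
   -2t Re(f y - f x). *)
have Ref y : `|y| <= 1 -> complex.Re (f y) <= complex.Re (f x) + t * (1 + Kt) / 2.
  move=> y1; have y'1 := ball_convex (_ : 0 <= t <= 1) x1 y1.
  have /Smin {y'1} : `|(t%:C)%C *: (-1 *: x + y) + x| <= 1 by apply: y'1; rewrite ltW.
  have -> : D ((t%:C)%C *: (-1 *: x + y) + x) =
      D x - 2 * t * complex.Re (f y - f x) +
      t ^+ 2 * \sum_(i < k) cabs (phi i y - phi i x) ^+ 2.
    rewrite /D /f -sumrB Re_sum !mulr_sumr -sumrB -big_split /=.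
    apply: eq_bigr => i _; have [l _] := dphi i (ltn_ord i).
    rewrite -mulrBr -/(a i) -sqr_cabs_sub !l /a; congr (cabs _ ^+ 2); ring.
  have : \sum_(i < k) cabs (phi i y - phi i x) ^+ 2 <= Kt.
    apply: ler_sum => i _; have [K0 KiP] := KP i.
    rewrite ler_pXn2r ?nnegrE ?cabs_ge0 ?mulr_ge0 //.
    by apply: le_trans (cabsB _ _) _; have := KiP _ x1; have := KiP _ y1; lra.
  set s := \sum_(i < k) _; rewrite ReB => sK hD.
  have : 2 * t * (complex.Re (f y) - complex.Re (f x)) <= t ^+ 2 * (1 + Kt) by nra.
  have -> : t ^+ 2 * (1 + Kt) = 2 * t * (t * (1 + Kt) / 2) by field.
  by rewrite ler_pM2l; lra.
(* A unimodular multiple of y turns the bound on the real part of f into one on its modulus. *)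
have dn : dnorm f <= complex.Re (f x) + t * (1 + Kt) / 2.
  apply: dnorm_le => y y1; have [b b1 bf] := phaseP (f y).
  have : `|b *: y| <= 1 by rewrite normrZ normcE_cabs b1 mul1r.
  move=> /Ref; have [l _] := df; have := l b y 0.
  by rewrite !addr0 (linear0_of l) addr0 => ->; rewrite bf.
have := P1 _ df; rewrite (Xbidual_sum (fun i => (a i)^*%C)) // => Pf.
have Dx : D x = complex.Re (\sum_(i < k) (a i)^*%C * Psi (phi i)) - complex.Re (f x).
  rewrite /f -ReB -sumrB Re_sum; apply: eq_bigr => i _; rewrite -mulrBr -/(a i).
  by rewrite sqr_cabs; case: (a i) => p q /=; ring.
have := De x x1; have := cabs_geRe (\sum_(i < k) (a i)^*%C * Psi (phi i)).
have := ler_norm (complex.Re (\sum_(i < k) (a i)^*%C * Psi (phi i))).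
by lra.
Qed.

End Helly.

(** * Representing elements of the bidual by functions in the target space *)

Section WeakVanishing.
Context {R : realType}.
Local Notation C := (R[i]).
Context (v : C -> R) (E : (C -> C) -> C -> C) (c : R).
Context (T : (C -> C) -> C -> C) (V : completeNormedModType C) (j : V -> C -> C).
Context (hv : typical_weight v) (hE : evaluation E) (c0 : 0 <= c).
Context (hT : intrinsic T) (hj : initial_space j).
Local Notation Y := (wspace v E).
Local Notation nY := (wnorm v E c).
Context (hb : bounded_op j Y nY T).

Lemma adjoint_Xdual L : Ydual Y nY L -> Xdual (adjoint j T L).
Proof.
move=> dL; have sT x : Y (T (j x)) by exact: (op_wspace hb).
have [Llin [ML MLP]] := dL; have [M M0 MP] := op_bounded hv hE c0 hb.
apply: (@Xdual_of_ball _ _ _ (`|ML| * M)) => [a x y|x x1].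
  rewrite /adjoint -Llin //; apply: (wdual_eqD hv hE c0 dL) => //.
    exact: wspace_lin.
  exact: (op_lin hT hj).
rewrite /adjoint; apply: le_trans (MLP _ (sT x)) _; apply: le_trans (ler_norm _) _.
rewrite normrM ler_wpM2l // ger0_norm; first exact: (MP x x1).1.
exact: wnorm_ge0.
Qed.

Definition weakstar_nbhs (Psi : (V -> C) -> C) (k : nat) (phi : nat -> V -> C) (e : R) :
  set V :=
  [set x | `|x| <= 1 /\ forall i, (i < k)%N -> cabs (phi i x - Psi (phi i)) < e].

(** The trace on the unit ball of X of the weak-star neighbourhoods of Psi; that it is proper is
    Goldstine's theorem. *)
Definition weakstar_filter (Psi : (V -> C) -> C) : set_system V :=
  [set A | exists k phi e, [/\ forall i, (i < k)%N -> Xdual (phi i), 0 < e &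
    weakstar_nbhs Psi k phi e `<=` A]].

Lemma weakstar_filter_proper Psi : Xbidual Psi ->
  (forall f, Xdual f -> cabs (Psi f) <= dnorm f) ->
  ProperFilter (weakstar_filter Psi).
Proof.
move=> bP P1; split.
  move=> [k [phi [e [dphi e0 sub]]]].
  by have [x xP] := helly bP P1 dphi e0; exact: (sub x xP).
split.
- by exists 0%N, (fun _ _ => 0), 1; split.
- move=> A B [k1 [p1 [e1 [d1 e10 s1]]]] [k2 [p2 [e2 [d2 e20 s2]]]].
  exists (k1 + k2)%N, (fun i => if (i < k1)%N then p1 i else p2 (i - k1)%N), (Num.min e1 e2).
  split.
  + move=> i ik; case: ifPn => [|i1]; first exact: d1.
    by apply: d2; rewrite ltn_subLR // leqNgt.
  + by rewrite lt_min e10.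
  + move=> x [x1 xP]; split; [apply: s1|apply: s2]; split => // i ik.
      by have := xP i (ltn_addr _ ik); rewrite ik lt_min => /andP[].
    have := xP (k1 + i)%N; rewrite ltn_add2l [(k1 + i < k1)%N]ltnNge leq_addr /= addKn lt_min.
    by move=> /(_ ik) /andP[].
- move=> A B AB [k [p [e [d e0 s]]]]; exists k, p, e; split => //.
  exact: subset_trans AB.
Qed.

(** Take for g a weak cluster point of T along the weak-star filter. Given L, some x makes L(Tx)
    close to L g and (T^* L)(x) close to Psi(T^* L), and these two values at x are the same
    number. *)
Lemma wcompact_represent Psi : wcompact_op j Y nY T -> Xbidual Psi ->
  (forall f, Xdual f -> cabs (Psi f) <= dnorm f) ->
  exists2 g, Y g & forall L, Ydual Y nY L -> Psi (adjoint j T L) = L g.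
Proof.
move=> hw bP P1; have PF := weakstar_filter_proper bP P1.
have [|g [Yg gP]] := hw _ PF.
  by exists 0%N, (fun _ _ => 0), 1; split => // x [].
exists g => // L dL; apply/eqP; rewrite -subr_eq0; apply/eqP; apply: cabs0_eq0.
apply/eqP; rewrite eq_le cabs_ge0 andbT; apply/ler_addgt0Pl => e e0; rewrite addr0.
have e2 : 0 < e / 2 by lra.
have [||x [[_ /(_ 0%N isT) h1] /(_ 0%N isT) h2]] :=
    gP 1%N (fun=> L) _ _ e2 (weakstar_nbhs Psi 1 (fun=> adjoint j T L) (e / 2)).
- by [].
- by exists 1%N, (fun=> adjoint j T L), (e / 2); split => // i _; exact: adjoint_Xdual.
have := cabsB (L (T (j x)) - L g) (adjoint j T L x - Psi (adjoint j T L)).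
have -> : L (T (j x)) - L g - (adjoint j T L x - Psi (adjoint j T L)) =
  Psi (adjoint j T L) - L g by rewrite /adjoint; ring.
by lra.
Qed.

Lemma weak_vanishes_of_wcompact : wcompact_op j Y nY T ->
  weak_vanishes (fun z => rscale (v z) (adjoint j T (fun g => E g z))).
Proof.
move=> hw Psi bP e e0; have [Plin [M MP]] := bP.
(* Helly's lemma wants a functional of norm at most 1; adding 1 keeps the divisor positive. *)
pose M' := `|M| + 1; have M0 : 0 < M' by rewrite ltr_wpDl.
pose Psi' f := ((M'^-1)%:C)%C * Psi f.
have cM (w : C) : cabs (((M'^-1)%:C)%C * w) = M'^-1 * cabs w.
  by rewrite cabsM cabsR ger0_norm // invr_ge0 ltW.
have P1 f : Xdual f -> cabs (Psi' f) <= dnorm f.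
  move=> df; rewrite cM ler_pdivrMl //; apply: le_trans (MP f df) _.
  have d0 : 0 <= dnorm f.
    by apply: le_trans (cabs_ge0 _) (@dnorm_ub _ _ f 0 df _); rewrite normr0.
  by rewrite ler_wpM2r // /M'; have := ler_norm M; lra.
have bP' : Xbidual Psi'.
  split; first by move=> a f1 f2 d1 d2; rewrite /Psi' Plin //; ring.
  by exists 1 => f /P1; rewrite mul1r.
have [g Yg gP] := wcompact_represent hw bP' P1.
have eM : 0 < e / M' by rewrite divr_gt0.
have [r r1 rP] := wspace_near Yg eM.
exists r; split => // z zr; have dz : disk z by have /andP[] := zr.
rewrite ger0_norm ?cabs_ge0 //.
have dE := wdual_ev hv hE c0 dz; have dA := adjoint_Xdual dE.
(* The zero functional is added to reach the form in which linearity of Psi is stated. *)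
have -> : rscale (v z) (adjoint j T (fun g => E g z)) =
    (fun x => ((v z)%:C)%C * adjoint j T (fun g => E g z) x + 0).
  by apply/funext => x; rewrite addr0.
rewrite Plin //; last exact: Xdual_zero.
rewrite Xbidual_zero // addr0 cabsM cabsR ger0_norm ?(ltW (weight_gt0 hv dz)) //.
have := gP _ dE; rewrite /Psi' => /(congr1 cabs); rewrite cM => hg.
have := rP z zr; rewrite -hg ltr_pdivlMr // mulrCA mulrAC mulVf ?mul1r //.
by rewrite gt_eqF.
Qed.

End WeakVanishing.

(** * The common statement and its two instances *)

Section Characterization.
Context {R : realType}.
Local Notation C := (R[i]).

Lemma compact_wcompact_characterization (v : C -> R) (E : (C -> C) -> C -> C) (c : R)
    (T : (C -> C) -> C -> C) (V : completeNormedModType C) (j : V -> C -> C) :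
  typical_weight v -> evaluation E -> 0 <= c -> intrinsic T -> initial_space j ->
  bounded_op j (wspace v E) (wnorm v E c) T ->
  (compact_op j (wspace v E) (wnorm v E c) T <->
     vanishes_at_boundary (fun z => v z * dnorm (adjoint j T (fun g => E g z)))) /\
  (wcompact_op j (wspace v E) (wnorm v E c) T <->
     weak_vanishes (fun z => rscale (v z) (adjoint j T (fun g => E g z)))).
Proof.
move=> hv hE c0 hT hj hb; split; split.
- exact: dnorm_vanishes_of_compact.
- exact: compact_of_dnorm_vanishes.
- exact: weak_vanishes_of_wcompact.
- by move=> _; exact: wcompact_of_bounded.
Qed.

End Characterization.

Theorem theorem3p2 (R : realType) (v : R[i] -> R)
  (T : (R[i] -> R[i]) -> (R[i] -> R[i]))
  (V : completeNormedModType R[i]) (j : V -> R[i] -> R[i]) :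
  typical_weight v -> intrinsic T -> initial_space j ->
  (bounded_op j (Hv0 v) (normHv v) T ->
     (compact_op j (Hv0 v) (normHv v) T <->
        vanishes_at_boundary (fun z => v z * dnorm (adjoint j T (evalK z)))) /\
     (wcompact_op j (Hv0 v) (normHv v) T <->
        weak_vanishes (fun z => rscale (v z) (adjoint j T (evalK z))))) /\
  (bounded_op j (Bv0 v) (normBv v) T ->
     (compact_op j (Bv0 v) (normBv v) T <->
        vanishes_at_boundary (fun z => v z * dnorm (adjoint j T (evalD z)))) /\
     (wcompact_op j (Bv0 v) (normBv v) T <->
        weak_vanishes (fun z => rscale (v z) (adjoint j T (evalD z))))).
Proof.
move=> hv hT hj; split=> hb.
  (* The spaces and evaluations agree by conversion; only the norms need rewriting. *)
  have eN : normHv v = wnorm v id 0.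
    by apply/funext => g; rewrite /wnorm mul0r add0r.
  rewrite eN in hb *.
  exact: (compact_wcompact_characterization hv evaluation_id (lexx 0) hT hj hb).
have eN : normBv v = wnorm v cderiv 1.
  by apply/funext => g; rewrite /wnorm mul1r.
rewrite eN in hb *.
exact: (compact_wcompact_characterization hv evaluation_cderiv ler01 hT hj hb).
Qed.
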